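(* Consider the frog model on $\mathbb{Z}$ with drift parameter $p$, where $\frac12\le p<1$. For Borel sets $B\subseteq[0,1]$ let $$\mu_n(B)=\frac{1}{|A_n|}\sum_{i\in A_n}\mathbf{1}_{\left\{\frac{Z_n^i-v_{\min}n}{(v_{\max}-v_{\min})n}\in B\right\}}$$ be the empirical distribution of the rescaled positions of the active frogs at time $n\ge 1$. Then, almost surely, the (random) measure $\mu_n$ converges weakly to the Lebesgue measure $\lambda$ on $[0,1]$ as $n\to\infty$.
   Context: Frog model on $\mathbb{Z}$ with drift parameter $p\in[\frac12,1]$: $\mathbb{N}=\{1,2,\dots\}$, $\mathbb{N}_0=\mathbb{N}\cup\{0\}$. Let $(X_k^i)_{i\in\mathbb{Z},k\in\mathbb{N}}$ be i.i.d. with $\mathbb{P}(X_1^0=1)=p=1-\mathbb{P}(X_1^0=-1)$, and $S_n^i=\sum_{k=1}^n X_k^i$ for $i\in\mathbb{Z}$, $n\in\mathbb{N}_0$. Initially there is one active frog at $0$ and one sleeping frog at every other site of $\mathbb{Z}$. An active frog moves at each discrete time step according to its own random walk; a sleeping frog does not move, and it becomes active the first time an active frog visits its site, after which it starts its own walk and can wake up other frogs. The frog initially at $i$ is activated at time $T_i\in\mathbb{N}_0\cup\{\infty\}$; formally, with $t(x,y)=\inf\{n\in\mathbb{N}_0: x+S_n^x=y\}$ ($\inf\emptyset=\infty$), $T_i=\inf \sum_{l=1}^{k} t(x_{l-1},x_l)$, the infimum being over all $k\in\mathbb{N}$ and finite sequences $x_0,\dots,x_k\in\mathbb{Z}$ with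 $x_0=0$, $x_k=i$; in particular $T_0=0$. Its location at time $n$ is $Z_n^i=i$ if $n<T_i$ and $Z_n^i=i+S^i_{n-T_i}$ if $n\ge T_i$. The set of active frogs at time $n$ is $A_n=\{i\in\mathbb{Z}:T_i\le n\}$; $M_n=\max_{i\in A_n}Z_n^i$ and $m_n=\min_{i\in A_n}Z_n^i$. There are constants $v_{\max}$ (positive) and $v_{\min}$, depending on $p$, with $v_{\max}=\lim_{n\to\infty}\frac{M_n}{n}$ and $v_{\min}=\lim_{n\to\infty}\frac{m_n}{n}$ almost surely. One has $v_{\min}=2p-1$ for $p>\frac12$, and $v_{\min}=-v_{\max}$ for $p=\frac12$ by symmetry. The measures $\mu_n$ are finite (total mass at most $1$) measures on $[0,1]$, and weak convergence is weak convergence of finite measures on $[0,1]$. *)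

(* Defs.v *)
From HB Require Import structures.
From mathcomp Require Import all_boot all_order all_algebra.
From mathcomp Require Import finmap.
From mathcomp Require Import all_classical all_reals all_analysis.

Set Implicit Arguments.
Unset Strict Implicit.
Unset Printing Implicit Defensive.

Import Order.TTheory GRing.Theory Num.Theory.
Import numFieldNormedType.Exports.

Local Open Scope classical_set_scope.
Local Open Scope ring_scope.

HB.instance Definition _ := isPointed.Build int 0.
HB.instance Definition _ := @isMeasurable.Build default_measure_display
  int discrete_measurable discrete_measurable0
  discrete_measurableC discrete_measurableU.

Section iid.
Context (d d' : measure_display) (T : measurableType d) (T' : measurableType d')
  (R : realType) (P : probability T R) (I : choiceType).

Definition mutually_independent (D : set I) (Y : I -> {RV P >-> T'}) :=
  forall (J : {fset I}) (B : I -> set T'),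
    [set` J] `<=` D -> (forall j, measurable (B j)) ->
    P (\bigcap_(j in [set` J]) Y j @^-1` B j) =
      (\prod_(j <- J) P (Y j @^-1` B j))%E.

Definition identically_distributed (D : set I) (Y : I -> {RV P >-> T'}) :=
  forall i j, D i -> D j -> forall B, measurable B ->
    distribution P (Y i) B = distribution P (Y j) B.

Definition iid (D : set I) (Y : I -> {RV P >-> T'}) :=
  mutually_independent D Y /\ identically_distributed D Y.

End iid.

(* The frog model as a deterministic function of the steps: [x i k] is the k-th
   step of the frog initially at i.  Only the steps with 1 <= k are used. *)
Section frog_model.
Context (R : realType).
Implicit Type x : int -> nat -> int.

Definition walk x (i : int) (n : nat) : int := \sum_(1 <= k < n.+1) x i k.

(* The infimum of the empty set is +oo. *)
Definition hitting_time x (y z : int) : \bar R :=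
  ereal_inf [set n%:R%:E | n in [set n : nat | y + walk x y n = z]].

Definition activation_time x (i : int) : \bar R :=
  ereal_inf [set s | exists (k : nat) (y : nat -> int),
    [/\ (0 < k)%N, y 0%N = 0, y k = i &
        s = (\sum_(1 <= l < k.+1) hitting_time x (y l.-1) (y l))%E]].

(* A finite [activation_time] is a natural number, which
   [Num.truncn (fine _)] recovers. *)
Definition position x (i : int) (n : nat) : int :=
  if (n%:R%:E < activation_time x i)%E then i
  else i + walk x i (n - Num.truncn (fine (activation_time x i))).

(* Always finite, whatever the steps are, and contains 0. *)
Definition active x (n : nat) : set int :=
  [set i | (activation_time x i <= n%:R%:E)%E].

Definition rightmost x (n : nat) : R :=
  sup [set (position x i n)%:~R | i in active x n].

Definition leftmost x (n : nat) : R :=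
  inf [set (position x i n)%:~R | i in active x n].

Definition rescaled_position (vmin vmax : R) x (n : nat) (i : int) : R :=
  ((position x i n)%:~R - vmin * n%:R) / ((vmax - vmin) * n%:R).

End frog_model.

Section empirical_measure.
Context (R : realType) (A : {fset int}) (z : int -> R).

Definition empirical_measure (B : set (measurableTypeR R)) : \bar R :=
  ((#|` A|%:R)^-1 * \sum_(i <- A) \1_B (z i))%:E.

Let empirical_measureE : empirical_measure =
  mscale ((#|` A|%:R)^-1)%:nng
    (msum (fun k => @dirac _ (measurableTypeR R) (z (nth 0 A k)) R) #|` A|).
Proof.
apply/funext => B; rewrite /empirical_measure /mscale /msum /= EFinM.
rewrite -sumEFin (big_nth 0) big_mkord; congr (_ * _)%E.
Qed.

Let empirical_measure0 : empirical_measure set0 = 0%E.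
Proof. by rewrite empirical_measureE measure0. Qed.

Let empirical_measure_ge0 B : (0 <= empirical_measure B)%E.
Proof. by rewrite empirical_measureE measure_ge0. Qed.

Let empirical_measure_sigma_additive : semi_sigma_additive empirical_measure.
Proof. rewrite empirical_measureE; exact: measure_semi_sigma_additive. Qed.

HB.instance Definition _ := isMeasure.Build _ _ _ empirical_measure
  empirical_measure0 empirical_measure_ge0 empirical_measure_sigma_additive.

End empirical_measure.

(* The measure mu_n.  It is defined on all Borel sets of the line; as a measure
   on [0, 1] it is its restriction to the Borel subsets of [0, 1], which may
   have mass less than 1. *)
Definition frog_measure (R : realType) (vmin vmax : R)
    (x : int -> nat -> int) (n : nat) : {measure set (measurableTypeR R) -> \bar R} :=
  empirical_measure (fset_set (active R x n)) (rescaled_position vmin vmax x n).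

(* Weak convergence of the restrictions to [0, 1].  The values of f outside
   [0, 1] play no role, and f is bounded on [0, 1] by compactness. *)
Definition weak_cvg01 (R : realType)
    (mu : nat -> {measure set (measurableTypeR R) -> \bar R})
    (nu : {measure set (measurableTypeR R) -> \bar R}) :=
  forall f : R -> R, {within `[0, 1], continuous f} ->
    (fun n => \int[mu n]_(t in `[0%R, 1%R]) (f t)%:E)%E @ \oo -->
      (\int[nu]_(t in `[0%R, 1%R]) (f t)%:E)%E.

(* Main.v *)
Require Import Defs.
From HB Require Import structures.
From mathcomp Require Import all_boot all_order all_algebra.
From mathcomp Require Import finmap.
From mathcomp Require Import all_classical all_reals all_analysis.
From mathcomp Require Import measurable_realfun ring lra zify.
Set Implicit Arguments.
Unset Strict Implicit.
Unset Printing Implicit Defensive.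
Import Order.TTheory GRing.Theory Num.Theory.
Import numFieldNormedType.Exports.
Local Open Scope classical_set_scope.
Local Open Scope ring_scope.

(** Probability enters through a law of large numbers and through relations
    between the speeds; the rest concerns a fixed realisation of the steps.

    Write mu = 2p - 1 for the drift and T_i for the activation time of frog i.
    The steps being +-1, the woken sites at time n form an integer interval
    [-l, r].  A woken site carries its own frog at the moment it is woken, and
    a site carrying an active frog is woken; hence r follows the maximal
    position, r ~ vmax n, and in the same way l ~ max(-vmin, 0) n
    ([active_range_right_speed], applied to the steps and to their mirror
    image).  Inverting the first relation gives T_i ~ i / vmax for i >= 0.
    A law of large numbers that is uniform over all frogs and all times
    ([ae_uniform_lln]) places frog i at time n near i + mu (n - T_i), that is
    near mu n + i (1 - mu / vmax): up to o(n) the position of a frog is an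
    affine function of its label ([position_profile]).  After rescaling, the
    frog of label i sits within o(1) of (i + l) / (l + r + 1), uniformly in i
    ([rescaled_position_near_uniform]), so that integrals against the empirical
    measure are Riemann sums ([empirical_sum_cvg]).

    For this affine map to send the labels onto [0, 1], and for the rescaling
    to be meaningful, the speeds must be related.  When p = 1/2 the drift
    vanishes, positions are labels up to o(n), and vmin <= 0 < vmax suffices.
    When p > 1/2 one needs vmin = mu and mu < vmax.  Frog 0 gives vmin <= mu.
    For the converse, with positive probability no frog started at a site
    i >= 0 ever visits a negative site ([exists_no_left_escape]); then only
    labels i >= 0 are active and their positions are at least mu n - o(n)
    ([drift_le_left_speed]).  Since vmin is a constant, one such outcome is
    enough.  For mu < vmax, a strategy that follows two frogs as long as both
    stand at the front advances strictly faster than a single walk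
    ([ae_strategy_small], [strategy_speed]).

    All three probabilistic facts are exponential moment bounds: a family of
    nonnegative variables indexed by pairs of integers has geometrically small
    expectations, so its sum is integrable, and the sum dominates each term
    ([integral_double_series_le], [ae_bounded_of_geometric]).  The expectations
    are computed on decision trees, which read one fresh step at a time
    ([integral_tree_eval]). *)

(** * Geometrically small double series *)

Lemma nneseries_geometric (R : realType) (K r : R) : 0 <= r -> r < 1 ->
  (\sum_(0 <= n <oo) (K * r ^+ n)%:E = (K / (1 - r))%:E)%E.
Proof.
move=> r0 r1; apply/cvg_lim => //.
under eq_fun do rewrite sumEFin.
apply: cvg_EFin; first by apply: nearW => n.
have := @cvg_geometric_series R K r; rewrite ger0_norm // => /(_ r1).
by apply: cvg_trans.
Qed.

Section double_series.
Local Open Scope ereal_scope.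
Context d (T : measurableType d) (R : realType) (P : {measure set T -> \bar R}).

Definition double_series (Y : nat -> nat -> T -> R) (w : T) : \bar R :=
  \sum_(0 <= a <oo) \sum_(0 <= m <oo) (Y a m w)%:E.

Lemma double_series_ge (Y : nat -> nat -> T -> R) w a m :
  (forall a m, 0 <= Y a m w)%R -> (Y a m w)%:E <= double_series Y w.
Proof.
move=> Y0; have inner b k : (Y b k w)%:E <= \sum_(0 <= m <oo) (Y b m w)%:E.
  apply: (@le_trans _ _ (\sum_(0 <= m < k.+1) (Y b m w)%:E)).
    rewrite big_nat_recr//= leeDr// sume_ge0// => i _; exact: Y0.
  by apply: nneseries_lim_ge => i _ _; exact: Y0.
apply: (le_trans (inner a m)).
apply: (@le_trans _ _ (\sum_(0 <= b < a.+1) \sum_(0 <= m <oo) (Y b m w)%:E)).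
  rewrite big_nat_recr//= leeDr// sume_ge0// => i _.
  by apply: nneseries_ge0 => *; exact: Y0.
apply: nneseries_lim_ge => i _ _.
by apply: nneseries_ge0 => *; exact: Y0.
Qed.

Context (D : set T) (mD : measurable D) (Y : nat -> nat -> T -> R).
Hypothesis mY : forall a m, measurable_fun D (Y a m).
Hypothesis Y0 : forall a m w, (0 <= Y a m w)%R.

Lemma measurable_double_series : measurable_fun D (double_series Y).
Proof.
apply: ge0_emeasurable_sum => [a w _ _|a _].
  by apply: nneseries_ge0 => *; rewrite lee_fin.
apply: ge0_emeasurable_sum => [m w _ _|m _]; first by rewrite lee_fin.
exact/measurable_EFinP.
Qed.

Lemma integral_double_series_le (K r : R) : (0 <= r)%R -> (r < 1)%R ->
  (forall a m, \int[P]_(w in D) (Y a m w)%:E <= (K * r ^+ (a + m))%:E) ->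
  \int[P]_(w in D) double_series Y w <= (K / (1 - r) ^+ 2)%:E.
Proof.
move=> r0 r1 HY; rewrite /double_series integral_nneseries//; last 2 first.
- move=> a; apply: ge0_emeasurable_sum => [m w _ _|m _].
    by rewrite lee_fin.
  exact/measurable_EFinP.
- by move=> a w _; apply: nneseries_ge0 => *; rewrite lee_fin.
apply: (@le_trans _ _ (\sum_(0 <= a <oo) ((K / (1 - r)) * r ^+ a)%:E)); last first.
  by rewrite nneseries_geometric// -mulrA -invfM expr2.
apply: lee_nneseries => [a _ _|a _].
  by apply: integral_ge0 => w _; apply: nneseries_ge0 => *; rewrite lee_fin.
rewrite integral_nneseries//; last 2 first.
- by move=> m; exact/measurable_EFinP.
- by move=> m w _; rewrite lee_fin.
rewrite mulrAC -(nneseries_geometric _ r0 r1).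
apply: lee_nneseries => [m _ _|m _].
  by apply: integral_ge0 => w _; rewrite lee_fin.
by apply: (le_trans (HY a m)); rewrite exprD mulrA.
Qed.

End double_series.

(** The sum of all the [Y a m] has finite integral, hence is finite almost
    everywhere, and it bounds every term.  For exponential [Y], taking
    logarithms yields linear bounds with a random additive constant; this takes
    the place of the Borel-Cantelli lemma. *)
Lemma ae_bounded_of_geometric d (T : measurableType d) (R : realType)
    (P : {measure set T -> \bar R}) (Y : nat -> nat -> T -> R) (K r : R) :
  (forall a m, measurable_fun setT (Y a m)) -> (forall a m w, 0 <= Y a m w) ->
  0 <= r -> r < 1 ->
  (forall a m, (\int[P]_w (Y a m w)%:E <= (K * r ^+ (a + m))%:E)%E) ->
  {ae P, forall w, exists C : R, forall a m, Y a m w <= C}.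
Proof.
move=> mY Y0 r0 r1 HY.
have I : P.-integrable setT (double_series Y).
  apply/integrableP; split; first exact: measurable_double_series.
  rewrite (@eq_integral _ _ _ _ _ (double_series Y)); last first.
    move=> w _; rewrite gee0_abs//.
    by apply: le_trans (double_series_ge 0 0 (fun a m => Y0 a m w)); rewrite lee_fin.
  by apply: le_lt_trans (integral_double_series_le _ _ _ r0 r1 HY) _ => //; rewrite ltry.
apply: filterS (integrable_ae measurableT I) => w /(_ Logic.I) fW.
exists (fine (double_series Y w)) => a m; rewrite -lee_fin fineK//.
exact: double_series_ge.
Qed.

(** * Decision trees over independent bits *)

Section decision_trees.
Context (I : eqType) (R : realType).

(** An adaptive experiment: a node reads a bit and goes on according to its
    value, the leaves carry the outcome. *)
Inductive dtree := Leaf of R | Node of I & dtree & dtree.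

Fixpoint tree_eval (c : I -> bool) (t : dtree) : R :=
  match t with
  | Leaf r => r
  | Node j t1 t0 => if c j then tree_eval c t1 else tree_eval c t0
  end.

Fixpoint tree_mean (p : R) (t : dtree) : R :=
  match t with
  | Leaf r => r
  | Node j t1 t0 => p * tree_mean p t1 + (1 - p) * tree_mean p t0
  end.

Fixpoint leaves_ge0 (t : dtree) : bool :=
  match t with
  | Leaf r => 0 <= r
  | Node _ t1 t0 => leaves_ge0 t1 && leaves_ge0 t0
  end.

(** [s] lists the bits that have already been read. *)
Fixpoint reads_fresh (D : pred I) (s : seq I) (t : dtree) : bool :=
  match t with
  | Leaf _ => true
  | Node j t1 t0 =>
    [&& D j, j \notin s, reads_fresh D (j :: s) t1 & reads_fresh D (j :: s) t0]
  end.

Lemma eval_ge0 c t : leaves_ge0 t -> 0 <= tree_eval c t.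
Proof.
by elim: t => //= j t1 ih1 t0 ih0 /andP[/ih1 ? /ih0 ?]; case: ifP.
Qed.

(** The non-adaptive experiment, with outcome a product over [s]; [acc] is
    the part of the product already collected. *)
Fixpoint product_tree (g : I -> bool -> R) (s : seq I) (acc : R) : dtree :=
  if s is j :: s' then
    Node j (product_tree g s' (acc * g j true))
           (product_tree g s' (acc * g j false))
  else Leaf acc.

Lemma eval_product_tree c g s acc :
  tree_eval c (product_tree g s acc) = acc * \prod_(j <- s) g j (c j).
Proof.
elim: s acc => [|j s ih] acc /=; first by rewrite big_nil mulr1.
by rewrite big_cons mulrA; case: (c j); rewrite ih.
Qed.

Lemma mean_product_tree p g s acc : tree_mean p (product_tree g s acc) =
  acc * \prod_(j <- s) (p * g j true + (1 - p) * g j false).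
Proof.
elim: s acc => [|j s ih] acc /=; first by rewrite big_nil mulr1.
by rewrite big_cons !ih; ring.
Qed.

Lemma leaves_ge0_product_tree g s acc : 0 <= acc -> (forall j e, 0 <= g j e) ->
  leaves_ge0 (product_tree g s acc).
Proof.
move=> acc0 g0; elim: s acc acc0 => [|j s ih] acc acc0 //=.
by rewrite !ih// mulr_ge0.
Qed.

Lemma reads_fresh_product_tree (D : pred I) g s s' acc :
  all D s -> uniq s -> all [predC s'] s -> reads_fresh D s' (product_tree g s acc).
Proof.
elim: s s' acc => [|j s ih] s' acc //= /andP[Dj Ds] /andP[js us] /andP[js' ss'].
rewrite Dj js'/=; have ss'' : all [predC (j :: s')] s.
  apply/allP => i si; move/allP : ss' => /(_ _ si) /=; rewrite !inE negb_or => ->.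
  by rewrite andbT; apply: contraNneq js => <-.
by rewrite !ih.
Qed.

Context d (T : measurableType d) (P : probability T R) (p : R) (D : pred I).
Context (b : I -> T -> bool).

Definition cylinder (s : seq (I * bool)) : set T :=
  [set w | all (fun je => b je.1 w == je.2) s].

Definition bit_weight (e : bool) : R := if e then p else 1 - p.

(** Independence is stated on cylinders, the events that prescribe
    finitely many bits. *)
Definition bernoulli_bits : Prop :=
  (forall j, measurable_fun setT (b j)) /\
  forall s : seq (I * bool), uniq (unzip1 s) -> all D (unzip1 s) ->
    P (cylinder s) = (\prod_(je <- s) bit_weight je.2)%:E.

Hypothesis Hb : bernoulli_bits.

Lemma measurable_bit j e : measurable [set w | b j w == e].
Proof.
have := Hb.1 j measurableT [set e] Logic.I; rewrite setTI; congr (measurable _).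
by apply/seteqP; split => w /= /eqP.
Qed.

Lemma measurable_cylinder s : measurable (cylinder s).
Proof.
elim: s => [|je s ih]; first by rewrite /cylinder (_ : [set _ | _] = setT)//; apply/seteqP.
rewrite (_ : cylinder _ = [set w | b je.1 w == je.2] `&` cylinder s).
  by apply: measurableI => //; exact: measurable_bit.
by rewrite /cylinder; apply/seteqP; split => w /=; [move=> /andP[]|move=> [-> ->]].
Qed.

Lemma measurable_eval t : measurable_fun setT (fun w => tree_eval (b ^~ w) t).
Proof.
elim: t => [r|j t1 ih1 t0 ih0] /=; first exact: measurable_cst.
by apply: measurable_fun_ifT => //; exact: Hb.1.
Qed.

(** Which bit is read next may depend on the bits read so far, but since it
    is a fresh one it splits the current cylinder in proportions [p] and
    [1 - p].  This is why the expectation obeys the recursion of [tree_mean]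
    although the set of bits read is random. *)
Lemma integral_tree_eval s t : uniq (unzip1 s) -> all D (unzip1 s) ->
  leaves_ge0 t -> reads_fresh D (unzip1 s) t ->
  (\int[P]_(w in cylinder s) (tree_eval (b ^~ w) t)%:E =
   ((\prod_(je <- s) bit_weight je.2) * tree_mean p t)%:E)%E.
Proof.
elim: t s => [r|j t1 ih1 t0 ih0] s us Ds /=.
  move=> r0 _; rewrite integral_cst; last exact: measurable_cylinder.
  by rewrite [X in (_ * X)%E](Hb.2 s us Ds) -EFinM mulrC.
move=> /andP[t10 t00] /and4P[Dj js F1 F0].
have -> : cylinder s = cylinder ((j, true) :: s) `|` cylinder ((j, false) :: s).
  apply/seteqP; split => [w ws|w]; rewrite /cylinder/=.
    by move: ws; rewrite /cylinder/= => ->; case: (b j w); [left|right].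
  by move=> [] /andP[].
have mt := @measurable_eval (Node j t1 t0).
have ge0 w : 0 <= tree_eval (b^~ w) (Node j t1 t0) by apply: eval_ge0 => /=; rewrite t10.
rewrite ge0_integral_setU; [|exact: measurable_cylinder|exact: measurable_cylinder|
    apply/measurable_EFinP; exact: measurable_funTS |
    by move=> w _; rewrite lee_fin; exact: ge0|]; last first.
  rewrite disj_set2E; apply/eqP/seteqP; split => // w.
  by rewrite /cylinder /= => -[/andP[/eqP -> _] /andP[]].
rewrite (@eq_integral _ _ _ _ _ (fun w => (tree_eval (b^~ w) t1)%:E)); last first.
  by move=> w; rewrite inE => /andP[/= /eqP bj _] /=; rewrite bj.
rewrite [X in (_ + X)%E](@eq_integral _ _ _ _ _ (fun w => (tree_eval (b^~ w) t0)%:E)); last first.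
  by move=> w; rewrite inE => /andP[/= /eqP bj _] /=; rewrite bj.
rewrite ih1 ?ih0//= ?js ?Dj//.
by rewrite -EFinD !big_cons/=; congr EFin; ring.
Qed.

End decision_trees.

(** * Steps as independent bits *)

Lemma ae_forall_countable d (T : measurableType d) (R : realType)
    (P : {measure set T -> \bar R}) (I : countType) (Q : I -> T -> Prop) :
  (forall i, {ae P, forall w, Q i w}) -> {ae P, forall w, forall i, Q i w}.
Proof.
move=> HQ; have : {ae P, forall w, forall n,
    (if (choice.unpickle n : option I) is Some i then Q i w else True)}.
  apply: ae_foralln => n; case: (choice.unpickle n : option I) => [i|]; first exact: HQ.
  by apply: nearW.
by apply: filterS => w Hw i; have := Hw (choice.pickle i); rewrite choice.pickleK.
Qed.

Lemma uniq_unzip1_inj (I J : eqType) (s : seq (I * J)) i x y :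
  uniq (unzip1 s) -> (i, x) \in s -> (i, y) \in s -> x = y.
Proof.
elim: s => //= -[j z] s ih /= /andP[js us]; rewrite !in_cons.
have nin u : (j, u) \notin s.
  by apply: contra js => ju; apply/mapP; exists (j, u).
case/orP => [/eqP[-> ->]|ix]; case/orP => [/eqP[]|iy].
- by move=> ->.
- by rewrite (negbTE (nin _)) in iy.
- by move=> E _; rewrite E (negbTE (nin _)) in ix.
- exact: ih.
Qed.

Section bits_of_steps.
Context (R : realType) (d : measure_display) (T : measurableType d)
  (P : probability T R) (p : R) (X : int -> nat -> {RV P >-> int}).
Hypothesis iidX :
  iid [set ik : int * nat | (1 <= ik.2)%N] (fun ik => X ik.1 ik.2).
Hypothesis Xp : P (X 0 1%N @^-1` [set 1]) = p%:E.

(** Every value other than 1 is recorded as [false].  This alters the model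
    on a null set only, by [ae_step_pm1], and leaves exactly two values
    everywhere. *)
Definition step_bit (ik : int * nat) (w : T) : bool := X ik.1 ik.2 w == 1.

Lemma step_law (ik : int * nat) (B : set int) : (1 <= ik.2)%N ->
  P (X ik.1 ik.2 @^-1` B) = P (X 0 1%N @^-1` B).
Proof.
by move=> k1; have := iidX.2 ik (0, 1%N) k1 isT B; apply.
Qed.

Lemma measurable_step i k (B : set int) : measurable (X i k @^-1` B).
Proof. by rewrite -[_ @^-1` _]setTI; exact: measurable_funP. Qed.

Lemma bernoulli_step_bit : bernoulli_bits P p (fun ik => (1 <= ik.2)%N) step_bit.
Proof.
split=> [ik|s us Ds].
  apply: (@measurable_fun_bool _ _ _ _ true); rewrite setTI.
  have -> : step_bit ik @^-1` [set true] = X ik.1 ik.2 @^-1` [set 1].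
    by apply/seteqP; split => w /= /eqP.
  exact: measurable_step.
pose J : {fset int * nat} := [fset j in unzip1 s]%fset.
(* [s] lists each index once, so it prescribes one value per index. *)
pose B j := if (j, true) \in s then [set (1:int)] else ~` [set (1:int)].
have lab j e : (j, e) \in s -> ((j, true) \in s) = e.
  case: e => // jf; apply/negbTE/negP => jt.
  by have := uniq_unzip1_inj us jf jt.
have -> : cylinder step_bit s = \bigcap_(j in [set` J]) X j.1 j.2 @^-1` B j.
  apply/seteqP; split => w.
    move=> /allP Hw j; rewrite /= !inE => /mapP[[j' e] js /= ->].
    have := Hw _ js; rewrite /= /B (lab _ _ js) /step_bit => /eqP.
    by case: (e) => /= [/eqP|/negbT/eqP].
  move=> Hw; apply/allP => -[j e] js /=.
  have jJ : [set` J] j by rewrite /= !inE; apply/mapP; exists (j, e).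
  have := Hw j jJ; rewrite /= /B (lab _ _ js) /step_bit.
  by case: (e) => /= [->|/eqP/negbTE ->]; rewrite ?eqxx.
rewrite iidX.1//; last first.
  by move=> j; rewrite /= !inE => js; apply: (allP Ds).
rewrite (perm_big (unzip1 s))/=; last first.
  by apply: uniq_perm => // [|j]; rewrite ?fset_uniq// !inE.
rewrite big_map -prodEFin; apply: eq_big_seq => -[j e] js /=.
have j1 : (1 <= j.2)%N by apply: (allP Ds); apply/mapP; exists (j, e).
rewrite step_law// /B (lab _ _ js); case: (e) => //=.
rewrite -preimage_setC probability_setC; last exact: measurable_step.
by rewrite Xp.
Qed.

Hypothesis Xq : P (X 0 1%N @^-1` [set -1]) = (1 - p)%:E.

Lemma ae_step_pm1 : {ae P, forall w, forall i k, (1 <= k)%N ->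
  X i k w = 1 \/ X i k w = -1}.
Proof.
have : {ae P, forall w, forall ik : int * nat, (1 <= ik.2)%N ->
    X ik.1 ik.2 w = 1 \/ X ik.1 ik.2 w = -1}.
  apply: ae_forall_countable => ik.
  have [k1|k0] := boolP (1 <= ik.2)%N; last first.
    by apply: nearW => w /=.
  exists (X ik.1 ik.2 @^-1` ~` ([set 1] `|` [set -1])); split.
  - exact: measurable_step.
  - rewrite [LHS](step_law _ k1) -preimage_setC probability_setC; last exact: measurable_step.
    rewrite preimage_setU measureU//; try exact: measurable_step.
      rewrite [X in (_ - (X + _))%E]Xp [X in (_ - (_ + X))%E]Xq.
      have -> : (p%:E + (1 - p)%:E = 1%:E)%E by rewrite -EFinD addrC subrK.
      exact: subee.
    by apply/seteqP; split => w //= [->].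
  - by move=> w /= H; apply: contra_not H => H _.
by apply: filterS => w Hw i k; exact: (Hw (i, k)).
Qed.
End bits_of_steps.

(** * A law of large numbers uniform over all frogs *)

(** The bound 1 - x <= exp(-x) gives (1 - x) exp(x) <= 1, and
    1 <= (1 - x) (1 + x + 2x^2) for x <= 1/2. *)
Lemma expR_le_quadratic (R : realType) (x : R) :
  x <= 2^-1 -> expR x <= 1 + x + 2 * x ^+ 2.
Proof.
move=> x2; have x1 : 0 < 1 - x by lra.
rewrite -(ler_pM2r x1); apply: (@le_trans _ _ 1); last by nra.
have := expR_ge1Dx (- x); rewrite expRN => H.
by rewrite mulrC -ler_pdivlMr ?expR_gt0// div1r.
Qed.

(** Centring removes the linear term, and the variance 4p(1 - p) is at
    most 1. *)
Lemma coin_mgf_le (R : realType) (p t : R) : 0 <= p <= 1 -> `|t| <= 4^-1 ->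
  p * expR (t * (1 - (2 * p - 1))) + (1 - p) * expR (t * (- 1 - (2 * p - 1))) <=
  expR (2 * t ^+ 2).
Proof.
move=> /andP[p0 p1]; rewrite ler_norml => /andP[t1 t2].
have /expR_le_quadratic H1 : t * (1 - (2 * p - 1)) <= 2^-1.
  have : 0 <= (4^-1 - t) * (1 - p) by rewrite mulr_ge0 ?subr_ge0.
  by move: t2 p0; lra.
have /expR_le_quadratic H2 : t * (- 1 - (2 * p - 1)) <= 2^-1.
  have : 0 <= (4^-1 + t) * p by rewrite mulr_ge0// -lerBlDl sub0r.
  by move: t1 p1; lra.
apply: le_trans (expR_ge1Dx _).
apply: (@le_trans _ _ (p * (1 + t * (1 - (2 * p - 1)) + 2 * (t * (1 - (2 * p - 1))) ^+ 2)
  + (1 - p) * (1 + t * (- 1 - (2 * p - 1)) + 2 * (t * (- 1 - (2 * p - 1))) ^+ 2))).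
  by rewrite lerD// ler_wpM2l// subr_ge0.
have -> : p * (1 + t * (1 - (2 * p - 1)) + 2 * (t * (1 - (2 * p - 1))) ^+ 2)
  + (1 - p) * (1 + t * (- 1 - (2 * p - 1)) + 2 * (t * (- 1 - (2 * p - 1))) ^+ 2) =
  1 + 2 * t ^+ 2 * (4 * p * (1 - p)) by ring.
rewrite lerD2l -[leRHS]mulr1 ler_wpM2l//; first by rewrite mulr_ge0// sqr_ge0.
by have := sqr_ge0 (2 * p - 1); lra.
Qed.

Section law_of_large_numbers.
Context (R : realType) (d : measure_display) (T : measurableType d)
  (P : probability T R) (p : R) (b : int * nat -> T -> bool).
Hypothesis p01 : 0 <= p <= 1.
Hypothesis Hb : bernoulli_bits P p (fun ik => (1 <= ik.2)%N) b.

Definition pm1 (e : bool) : R := if e then 1 else -1.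

Definition bit_walk (w : T) (i : int) (m : nat) : R :=
  \sum_(1 <= k < m.+1) pm1 (b (i, k) w).

Definition walk_reads (i : int) (m : nat) : seq (int * nat) :=
  [seq (i, k) | k <- iota 1 m].

Lemma walk_reads_uniq i m : uniq (walk_reads i m).
Proof. by rewrite map_inj_uniq ?iota_uniq// => k l []. Qed.

Lemma walk_reads_pos i m : all (fun ik => (1 <= ik.2)%N) (walk_reads i m).
Proof.
by apply/allP => ik /mapP[k]; rewrite mem_iota => /andP[k1 _] ->.
Qed.

Lemma expR_bit_walk w i m (t c : R) : expR (t * bit_walk w i m + c * m%:R) =
  \prod_(j <- walk_reads i m) expR (t * pm1 (b j w) + c).
Proof.
rewrite big_map -expR_sum; congr expR.
rewrite big_split/= -mulr_sumr /bit_walk /index_iota subn1/=; congr (_ + _).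
by rewrite big_const_seq count_predT size_iota iter_addr addr0 mulr_natr.
Qed.

(** With t = eps / 4, the growth exp(2 t^2 m) of the exponential moment of
    the centred walk is half as fast as the decay exp(- t eps (a + m)) of the
    weight, so the weighted moments are geometrically small in a + m. *)
Lemma ae_one_sided_lln (sgn : R) (site : nat -> int) (eps : R) :
  `|sgn| = 1 -> 0 < eps -> eps <= 1 ->
  {ae P, forall w, exists C : R, forall a m,
    sgn * (bit_walk w (site a) m - (2 * p - 1) * m%:R) <= eps * (a + m)%:R + C}.
Proof.
move=> sgn1 e0 e1; have /andP[p0 p1] := p01; set mu := 2 * p - 1.
pose t := eps / 4; have t0 : 0 < t by rewrite /t divr_gt0.
pose g (j : int * nat) (e : bool) := expR (sgn * t * pm1 e + - (sgn * t * mu)).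
pose tree a m := product_tree g (walk_reads (site a) m) (expR (- (t * eps * (a + m)%:R))).
pose Y a m w := tree_eval (b ^~ w) (tree a m).
have YE a m w : Y a m w =
    expR (t * (sgn * (bit_walk w (site a) m - mu * m%:R) - eps * (a + m)%:R)).
  rewrite /Y eval_product_tree -(expR_bit_walk _ _ _ (sgn * t)) -expRD.
  by congr expR; ring.
have tree0 a m : leaves_ge0 (tree a m).
  by apply: leaves_ge0_product_tree => [|j e]; exact: expR_ge0.
have := @ae_bounded_of_geometric _ _ _ P Y 1 (expR (- (t * eps / 2))).
case/(_ _ _ _ _ _)/wrap.
- by move=> a m; exact: measurable_eval Hb _.
- by move=> a m w; exact: eval_ge0.
- exact: expR_ge0.
- by rewrite expR_lt1 oppr_lt0 divr_gt0// mulr_gt0.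
- move=> a m; have := @integral_tree_eval _ _ _ _ _ _ _ _ Hb [::] (tree a m).
  rewrite (_ : cylinder b [::] = setT); last by apply/seteqP.
  move=> -> //; last first.
    apply: reads_fresh_product_tree; [exact: walk_reads_pos|exact: walk_reads_uniq|].
    by apply/allP.
  rewrite lee_fin big_nil !mul1r mean_product_tree.
  apply: (@le_trans _ _ (expR (- (t * eps * (a + m)%:R)) *
      \prod_(j <- walk_reads (site a) m) expR (t * eps / 2))).
    rewrite ler_wpM2l ?expR_ge0//; apply: ler_prod => j _.
    rewrite addr_ge0 ?mulr_ge0 ?expR_ge0 ?subr_ge0//=.
    have /(coin_mgf_le p01) : `|sgn * t| <= 4^-1.
      by rewrite normrM sgn1 mul1r gtr0_norm//; rewrite /t; lra.
    rewrite exprMn (_ : sgn ^+ 2 = 1) ?mul1r; last first.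
      by rewrite -real_normK ?num_real// sgn1 expr1n.
    have -> : 2 * t ^+ 2 = t * eps / 2 by rewrite /t; field.
    apply: le_trans; rewrite /g /pm1 -/mu.
    by rewrite le_eqVlt; apply/orP; left; apply/eqP; congr (_ * expR _ + _ * expR _); ring.
  rewrite big_const_seq count_predT size_map size_iota -Monoid.iteropE.
  rewrite -/(expR (t * eps / 2) ^+ m) -!expRM_natl -expRD ler_expR natrD.
  have := ler0n R a; have : 0 < t * eps by rewrite mulr_gt0.
  move: (t * eps) (a%:R : R) (m%:R : R) => u x y; nra.
apply: filterS => w [C HC].
exists (ln C / t) => a m; have := HC a m; rewrite YE => HY.
have C0 : 0 < C by apply: lt_le_trans HY; exact: expR_gt0.
move: HY; rewrite -ler_ln ?posrE ?expR_gt0// expRK.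
by rewrite mulrC -ler_pdivlMr// lerBlDl.
Qed.

(** Allowing an error proportional to the label as well as to the time makes
    the sum over all frogs converge.  It costs nothing: the frogs active at
    time n have labels at most n in absolute value. *)
Lemma ae_uniform_lln : {ae P, forall w, forall eps : R, 0 < eps ->
  exists C : R, forall i m,
    `|bit_walk w i m - (2 * p - 1) * m%:R| <= eps * (`|i|%N + m)%:R + C}.
Proof.
(* Both signs of the label and of the deviation, with eps = 1 / (n + 1): these
   are countably many one-sided statements. *)
pose sites (s : bool) (a : nat) : int := if s then a%:Z else - a%:Z.
have : {ae P, forall w, forall nss : nat * (bool * bool), exists C : R, forall a m,
    pm1 nss.2.1 * (bit_walk w (sites nss.2.2 a) m - (2 * p - 1) * m%:R) <=
    nss.1.+1%:R^-1 * (a + m)%:R + C}.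
  apply: ae_forall_countable => -[n [s1 s2]].
  apply: ae_one_sided_lln; first by rewrite /pm1; case: s1; rewrite ?normrN normr1.
    by rewrite invr_gt0.
  by rewrite invf_le1// ler1n.
apply: filterS => w Hw eps e0.
have [n Hn] : exists n : nat, n.+1%:R^-1 <= eps.
  exists (Num.truncn eps^-1); rewrite invf_ple ?posrE//.
  by rewrite ltW// truncnS_gt.
have [C1 H1] := Hw (n, (true, true)); have [C2 H2] := Hw (n, (true, false)).
have [C3 H3] := Hw (n, (false, true)); have [C4 H4] := Hw (n, (false, false)).
exists (`|C1| + `|C2| + `|C3| + `|C4|) => i m.
have ai : i = sites true `|i|%N \/ i = sites false `|i|%N.
  by rewrite /sites; case: i => k; [left|right] => //; rewrite NegzE abszN absz_nat.
have le : n.+1%:R^-1 * (`|i|%N + m)%:R <= eps * (`|i|%N + m)%:R by rewrite ler_wpM2r.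
have := ler_norm C1; have := ler_norm C2; have := ler_norm C3; have := ler_norm C4.
have := normr_ge0 C1; have := normr_ge0 C2; have := normr_ge0 C3; have := normr_ge0 C4.
rewrite ler_norml; case: ai => ai.
- have := H1 `|i|%N m; have := H3 `|i|%N m; rewrite -ai /pm1 /=.
  move: ((2 * p - 1) * _) (n.+1%:R^-1 * _) (eps * _) le => u v x *.
  by apply/andP; split; lra.
- have := H2 `|i|%N m; have := H4 `|i|%N m; rewrite -ai /pm1 /=.
  move: ((2 * p - 1) * _) (n.+1%:R^-1 * _) (eps * _) le => u v x *.
  by apply/andP; split; lra.
Qed.

End law_of_large_numbers.

(** * Absence of negative sites with positive probability *)

Section no_left_escape.
Context (R : realType) (d : measure_display) (T : measurableType d)
  (P : probability T R) (p : R) (b : int * nat -> T -> bool).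
Hypotheses (p12 : 2^-1 < p) (p1 : p <= 1).
Hypothesis Hb : bernoulli_bits P p (fun ik => (1 <= ik.2)%N) b.

Let mu : R := 2 * p - 1.
(** This value minimises - t mu + 2 t^2, the exponent that bounds the moment
    of one step. *)
Let t : R := mu / 4.
Let rho : R := expR (- (t * mu / 2)).
(** Half of the decay rate [rho] is kept in reserve: it provides the factor
    [r ^+ K] for the terms with [K < a + m]. *)
Let r : R := expR (- (t * mu / 4)).

Let mu0 : 0 < mu. Proof. by rewrite /mu; move: p12; lra. Qed.
Let mu1 : mu <= 1. Proof. by rewrite /mu; move: p1; lra. Qed.
Let t0 : 0 < t. Proof. by rewrite divr_gt0. Qed.
Let r1 : r < 1. Proof. by rewrite expR_lt1 oppr_lt0 divr_gt0// mulr_gt0. Qed.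
Let r0 : 0 <= r. Proof. exact: expR_ge0. Qed.

Let rhoE : rho = r ^+ 2.
Proof. by rewrite -expRM_natl; congr expR; field. Qed.

Let box (K : nat) : seq (int * nat) :=
  [seq (Posz i, k) | i <- iota 0 K.+1, k <- iota 1 K].

Let all_right (K : nat) : set T := cylinder b [seq (j, true) | j <- box K].

Let unzip1_box K : unzip1 [seq (j, true) | j <- box K] = box K.
Proof. by rewrite /unzip1 -map_comp map_id. Qed.

Let box_uniq K : uniq (box K).
Proof.
apply: allpairs_uniq; rewrite ?iota_uniq// => -[i k] [i' k'] _ _ /=.
by move=> [-> ->].
Qed.

Let box_pos K : all (fun ik => (1 <= ik.2)%N) (box K).
Proof.
apply/allP => ik /allpairsP[[i k] /= [_ + ->]].
by rewrite mem_iota => /andP[].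
Qed.

Let g (j : int * nat) (e : bool) : R := expR (- t * pm1 R e).

(** The factors of exp(- t (a + S_m)) that are determined on [all_right K]. *)
Let known (K a m : nat) : R :=
  expR (- (t * a%:R)) * \prod_(j <- walk_reads a m | j \in box K) expR (- t).

Let tree (K a m : nat) : dtree (int * nat)%type R :=
  product_tree g [seq j <- walk_reads a m | j \notin box K] (known K a m).

Let eval_tree (K a m : nat) (w : T) : all_right K w ->
  tree_eval (b ^~ w) (tree K a m) = expR (- t * (a%:R + bit_walk R b w a m)).
Proof.
move=> Kw; rewrite eval_product_tree /known big_filter -mulrA.
rewrite (_ : expR (- t * _) = expR (- (t * a%:R)) *
    \prod_(j <- walk_reads a m) expR (- t * pm1 R (b j w))); last first.
  rewrite mulrDr expRD mulNr; congr (_ * _).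
  rewrite -[in LHS](addr0 (- t * bit_walk _ _ _ _ _)).
  rewrite -(mul0r m%:R) expR_bit_walk; apply: eq_bigr => j _.
  by rewrite addr0.
congr (_ * _); rewrite [RHS](bigID (mem (box K)))/=; congr (_ * _).
apply: eq_bigr => j jK; have -> : b j w.
  by have /allP /(_ (j, true)) /= := Kw; rewrite mem_map ?jK => [/(_ isT)/eqP|? ? []].
by rewrite mulr1.
Qed.

Let expNt_le : expR (- t) <= rho.
Proof.
rewrite ler_expR lerN2 -mulrA ger_pMr//.
by move: mu1 mu0; lra.
Qed.

Let mgf_le : p * g (0, 0%N) true + (1 - p) * g (0, 0%N) false <= rho.
Proof.
have p01 : 0 <= p <= 1 by apply/andP; split; move: p12 p1; lra.
have tn : `|- t| <= 4^-1.
  by rewrite normrN gtr0_norm// /t ler_pdivrMr// mulVf.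
have := coin_mgf_le p01 tn; rewrite -/mu /g /pm1 => H.
rewrite -(ler_pM2l (expR_gt0 (t * mu))).
apply: le_trans (le_trans H _).
  rewrite le_eqVlt; apply/orP; left; apply/eqP; rewrite mulrDr.
  rewrite mulrCA -expRD [X in _ + X]mulrCA -expRD.
  by congr (_ * expR _ + _ * expR _); ring.
by rewrite -expRD ler_expR le_eqVlt; apply/orP; left; apply/eqP; rewrite /t; field.
Qed.

Let mean_tree (K a m : nat) : tree_mean p (tree K a m) <= rho ^+ (a + m).
Proof.
rewrite mean_product_tree exprD /known big_filter -mulrA; apply: ler_pM.
- exact: expR_ge0.
- apply: mulr_ge0; apply: prodr_ge0 => j _; first exact: expR_ge0.
  by rewrite addr_ge0 ?mulr_ge0 ?expR_ge0 ?subr_ge0//; move: p12; lra.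
- by rewrite mulrC -mulrN expRM_natl lerXn2r ?nnegrE ?expR_ge0.
have -> : rho ^+ m = \prod_(j <- walk_reads a m) rho.
  by rewrite big_const_seq count_predT size_map size_iota -Monoid.iteropE.
rewrite [leRHS](bigID (mem (box K)))/=; apply: ler_pM.
- by apply: prodr_ge0 => j _; exact: expR_ge0.
- apply: prodr_ge0 => j _.
  by rewrite addr_ge0 ?mulr_ge0 ?expR_ge0 ?subr_ge0//; move: p12; lra.
- by apply: ler_prod => j _; rewrite expR_ge0 expNt_le.
- apply: ler_prod => j _; apply/andP; split; last exact: mgf_le.
  by rewrite addr_ge0 ?mulr_ge0 ?expR_ge0 ?subr_ge0//; move: p12; lra.
Qed.

(** Let all steps in a large box be +1, an event of positive probability.
    While the time and the label are small no frog can be negative.  For the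
    other pairs (a, m) the moment of exp(- t (a + S_m)) given that event is at
    most rho^(a + m): known steps contribute exp(- t) <= rho, fresh ones
    the moment of a step, again at most rho.  For a large box these moments
    add up to less than 1, while each pair with a + S_m < 0 contributes at
    least 1.  The predicate [Q] lets the outcome be chosen inside any almost
    sure event. *)
Lemma exists_no_left_escape (Q : T -> Prop) : {ae P, forall w, Q w} ->
  exists w, Q w /\ forall a m : nat, 0 <= a%:R + bit_walk R b w a m.
Proof.
move=> aeQ; apply: contrapT => noQ.
have [K HK] : exists K : nat, r ^+ K / (1 - r) ^+ 2 < 1.
  have := @cvg_expr R r; rewrite ger0_norm// => /(_ r1) /cvgrPdist_lt.
  move=> /(_ ((1 - r) ^+ 2)); rewrite exprn_gt0 ?subr_gt0// => /(_ isT).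
  move=> [K _ /(_ K (leqnn K))]/=; rewrite sub0r normrN ger0_norm ?exprn_ge0// => HK.
  by exists K; rewrite ltr_pdivrMr ?mul1r// exprn_gt0// subr_gt0.
have p0 : 0 < p by move: p12; lra.
have PK : P (all_right K) = (p ^+ size (box K))%:E.
  have := Hb.2 [seq (j, true) | j <- box K]; rewrite unzip1_box => H.
  rewrite [LHS](H (box_uniq K) (box_pos K)) big_map/= big_const_seq count_predT.
  by rewrite -Monoid.iteropE.
have PK0 : 0 < p ^+ size (box K) by rewrite exprn_gt0.
have mK : measurable (all_right K) by exact: measurable_cylinder Hb _.
have tree_ge0 a m : leaves_ge0 (tree K a m).
  apply: leaves_ge0_product_tree => [|j e]; last exact: expR_ge0.
  by apply: mulr_ge0; [exact: expR_ge0|apply: prodr_ge0 => j _; exact: expR_ge0].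
pose Y a m w := if (a + m <= K)%N then 0 else tree_eval (b ^~ w) (tree K a m).
have Y0 a m w : 0 <= Y a m w by rewrite /Y; case: ifP => // _; exact: eval_ge0.
have mY a m : measurable_fun (all_right K) (Y a m).
  rewrite /Y; case: (a + m <= K)%N; first exact: measurable_cst.
  exact: measurable_funTS (measurable_eval Hb _).
have IY a m : (\int[P]_(w in all_right K) (Y a m w)%:E <=
    (p ^+ size (box K) * r ^+ K * r ^+ (a + m))%:E)%E.
  rewrite /Y; case: (leqP (a + m) K) => [_|Kam].
    by rewrite integral0 lee_fin !mulr_ge0 ?exprn_ge0// ltW.
  rewrite (integral_tree_eval Hb) ?unzip1_box//; last first.
    apply: reads_fresh_product_tree.
    - by apply/allP => j; rewrite mem_filter => /andP[_]; apply: allP (walk_reads_pos _ _) j.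
    - by rewrite filter_uniq// walk_reads_uniq.
    - by apply/allP => j; rewrite mem_filter => /andP[].
  rewrite lee_fin big_map/= big_const_seq count_predT -Monoid.iteropE -mulrA.
  rewrite ler_wpM2l ?(ltW PK0)//; apply: (le_trans (mean_tree _ _ _)).
  rewrite rhoE -exprM mul2n -addnn exprD ler_wpM2r ?exprn_ge0//.
  apply: ler_wiXn2l; [exact: r0|exact: ltW r1|exact: ltnW].
have := integral_double_series_le mK mY Y0 r0 r1 IY.
apply/negP; rewrite -ltNge.
apply: (@lt_le_trans _ _ (\int[P]_(w in all_right K) (cst 1%E w))%E).
  rewrite integral_cst// mul1e [ltRHS]PK lte_fin -mulrA gtr_pMr//.
apply: ae_ge0_le_integral => //.
- by move=> w _; apply: le_trans (double_series_ge 0 0 (fun a m => Y0 a m w)); rewrite lee_fin.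
- exact: measurable_double_series.
apply: filterS aeQ => w Qw Kw; have /existsNP[a /existsNP[m Ham]] :
    ~ forall a m : nat, 0 <= a%:R + bit_walk R b w a m.
  by move=> H; apply: noQ; exists w.
apply: le_trans (double_series_ge a m (fun a m => Y0 a m w)).
rewrite lee_fin /Y; case: ifPn => [amK|_]; last first.
  rewrite eval_tree// -[leLHS]expR0 ler_expR mulNr oppr_ge0 pmulr_rle0//.
  by apply/ltW; rewrite ltNge; apply/negP.
case: Ham; rewrite addr_ge0// /bit_walk big_nat_cond sumr_ge0// => k.
rewrite andbT => /andP[k1 km]; have -> : b (Posz a, k) w = true.
  have /allP /(_ ((Posz a, k), true)) /= := Kw.
  rewrite mem_map; last by move=> x y [].
  rewrite (_ : _ \in box K) => [/(_ isT)/eqP//|].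
  apply/allpairsP; exists (a, k); split; rewrite ?mem_iota//.
    by rewrite add0n ltnS (leq_trans (leq_addr m a)).
  by rewrite k1 /= add1n (leq_trans km)// ltnS (leq_trans (leq_addl a m)).
by rewrite /pm1.
Qed.
End no_left_escape.

(** * A strategy that beats the drift *)

Section two_frog_strategy.
Context (R : realType) (kap lam : R).

(** The front [F] is the first site beyond those known to be woken, or the
    site just woken if [h = 0]; the frog [c], of age [a], stands at [F - h].
    If [h > 0] this frog is followed alone.  If [h = 0] it shares the site [F]
    with the newly woken frog [F], and the front advances unless both step to
    the left: a failure of probability (1 - p)^2 instead of 1 - p, which is
    where the speed is gained.  A frog that is abandoned is never read again,
    so all readings are fresh. *)
Fixpoint strategy (n F h c a : nat) : dtree (int * nat)%type R :=
  if n is n'.+1 then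
    if h is h'.+1 then
      Node (Posz c, a.+1) (strategy n' F h' c a.+1) (strategy n' F h'.+2 c a.+1)
    else
      Node (Posz F, 1%N) (strategy n' F.+1 0 F 1)
        (Node (Posz c, a.+1) (strategy n' F.+1 0 c a.+1)
                             (strategy n' F.+1 2 c a.+1))
  else Leaf _ (expR (kap * h%:R - lam * F%:R)).

Lemma leaves_ge0_strategy n F h c a : leaves_ge0 (strategy n F h c a).
Proof.
elim: n F h c a => [|n ih] F h c a /=; first exact: expR_ge0.
by case: h => [|h] /=; rewrite !ih.
Qed.

Lemma reads_fresh_strategy n F h c a (s : seq (int * nat)) : (c < F)%N ->
  (forall i k, (i, k) \in s -> exists2 j : nat, i = Posz j &
     (j < F)%N /\ (j = c -> (k <= a)%N)) ->
  reads_fresh (fun ik => (1 <= ik.2)%N) s (strategy n F h c a).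
Proof.
elim: n F h c a s => [//|n ih] F h c a s cF Hs /=.
have cs : (Posz c, a.+1) \notin s.
  by apply/negP => /Hs[j [<-] [_ /(_ erefl)]]; rewrite ltnn.
have Fs : (Posz F, 1%N) \notin s.
  by apply/negP => /Hs[j [<-] []]; rewrite ltnn.
have readc F' s' : (c < F')%N -> (forall i k, (i, k) \in s' -> exists2 j : nat,
    i = Posz j & (j < F')%N /\ (j = c -> (k <= a)%N)) ->
    forall i k, (i, k) \in (Posz c, a.+1) :: s' -> exists2 j : nat,
      i = Posz j & (j < F')%N /\ (j = c -> (k <= a.+1)%N).
  move=> cF' Hs' i k; rewrite in_cons => /orP[/eqP[-> ->]|/Hs'[j -> [jF jc]]].
    by exists c.
  by exists j => //; split => // /jc /leqW.
case: h => [|h] /=; last first.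
  by rewrite cs !ih//; exact: readc.
have HF i k : (i, k) \in (Posz F, 1%N) :: s -> exists2 j : nat, i = Posz j &
    (j < F.+1)%N /\ (j = c -> (k <= a)%N).
  rewrite in_cons => /orP[/eqP[-> ->]|/Hs[j -> [jF jc]]].
    by exists F => //; split => // Fc; move: cF; rewrite Fc ltnn.
  by exists j => //; split => //; exact: leqW.
have cF1 : (c < F.+1)%N by exact: leqW.
rewrite Fs ih//=; last first.
  move=> i k; rewrite in_cons => /orP[/eqP[-> ->]|/Hs[j -> [jF jc]]].
    by exists F.
  by exists j => //; split => [|jE]; [exact: leqW|move: jF; rewrite jE ltnn].
rewrite in_cons negb_or cs andbT.
have -> /= : (Posz c, a.+1) != (Posz F, 1%N).
  by apply: contraTneq cF => -[-> _]; rewrite ltnn.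
by rewrite !ih//; exact: readc.
Qed.

(** At each step the mean of the potential exp(kap h - lam F) is multiplied by
    exp(- nu) at most; the two hypotheses say so for [h > 0] and [h = 0]. *)
Lemma mean_strategy_le (p nu : R) n F h c a : 0 <= p <= 1 ->
  p * expR (- kap) + (1 - p) * expR kap <= expR (- nu) ->
  expR (- lam) * (p + (1 - p) * p + (1 - p) ^+ 2 * expR (2 * kap)) <= expR (- nu) ->
  tree_mean p (strategy n F h c a) <= expR (kap * h%:R - lam * F%:R - nu * n%:R).
Proof.
move=> /andP[p0 p1] E1 E2; elim: n F h c a => [|n ih] F h c a /=.
  by rewrite mulr0 subr0.
have q0 : 0 <= 1 - p by rewrite subr_ge0.
case: h => [|h] /=.
  apply: (@le_trans _ _ (p * expR (kap * 0 - lam * F.+1%:R - nu * n%:R) +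
      (1 - p) * (p * expR (kap * 0 - lam * F.+1%:R - nu * n%:R) +
        (1 - p) * expR (kap * 2 - lam * F.+1%:R - nu * n%:R)))).
    by rewrite lerD ?ler_wpM2l// lerD ?ler_wpM2l//; exact: ih.
  have -> : expR (kap * 0 - lam * F%:R - nu * n.+1%:R) =
      expR (- lam * F%:R - nu * n%:R) * expR (- nu).
    by rewrite -expRD -natr1; congr expR; ring.
  have e2 : expR (kap * 2 - lam * F.+1%:R - nu * n%:R) =
      expR (- lam * F%:R - nu * n%:R) * (expR (- lam) * expR (2 * kap)).
    by rewrite -!expRD -natr1; congr expR; ring.
  have e0 : expR (kap * 0 - lam * F.+1%:R - nu * n%:R) =
      expR (- lam * F%:R - nu * n%:R) * expR (- lam).
    by rewrite -!expRD -natr1; congr expR; ring.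
  rewrite e0 e2; apply: le_trans (ler_wpM2l (expR_ge0 _) E2).
  by rewrite le_eqVlt; apply/orP; left; apply/eqP; ring.
apply: (@le_trans _ _ (p * expR (kap * h%:R - lam * F%:R - nu * n%:R) +
    (1 - p) * expR (kap * h.+2%:R - lam * F%:R - nu * n%:R))).
  by rewrite lerD ?ler_wpM2l//; exact: ih.
have -> : expR (kap * h.+1%:R - lam * F%:R - nu * n.+1%:R) =
    expR (kap * h.+1%:R - lam * F%:R - nu * n%:R) * expR (- nu).
  by rewrite -expRD -[n.+1%:R]natr1; congr expR; ring.
apply: le_trans (ler_wpM2l (expR_ge0 _) E1).
rewrite le_eqVlt; apply/orP; left; apply/eqP.
rewrite [RHS]mulrDr [X in _ = X + _]mulrCA [X in _ = _ + X]mulrCA -!expRD.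
by congr (_ * expR _ + _ * expR _); rewrite -!natr1; ring.
Qed.

End two_frog_strategy.

(** To first order in [kap], with q = 1 - p, the two inequalities ask for
    kap mu > lam mu and for lam > lam mu + 2 q^2 kap.  The choice
    lam = kap (1 - p / 2) meets both with a margin proportional to kap, by
    q^2 < q, and kap = mu p q / 32 makes the second order terms smaller than
    this margin. *)
Lemma strategy_rates (R : realType) (p : R) : 2^-1 < p -> p < 1 ->
  exists kap lam eta : R, [/\ 0 < kap, 0 < lam, 0 < eta,
   p * expR (- kap) + (1 - p) * expR kap <= expR (- (lam * (2 * p - 1 + 2 * eta))) &
   expR (- lam) * (p + (1 - p) * p + (1 - p) ^+ 2 * expR (2 * kap)) <=
     expR (- (lam * (2 * p - 1 + 2 * eta)))].
Proof.
move=> p2 p1; pose mu := 2 * p - 1; pose q := 1 - p.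
have mu0 : 0 < mu by rewrite /mu; lra.
have mu1 : mu <= 1 by rewrite /mu; lra.
have q0 : 0 < q by rewrite /q; lra.
have q1 : q <= 1 by rewrite /q; lra.
have p0 : 0 < p by lra.
pose e := mu * p * q; have e0 : 0 < e by rewrite !mulr_gt0.
have emp : e <= mu * p by rewrite ger_pMr// mulr_gt0.
have epq : e <= p * q by rewrite /e -mulrA ger_pMl// mulr_gt0.
have e1 : e <= 1.
  by apply: (le_trans emp); rewrite mulr_ile1// ltW.
pose kap := e / 32; have kap0 : 0 < kap by rewrite divr_gt0.
pose lam := kap * (1 - p / 2); have lam0 : 0 < lam by rewrite mulr_gt0//; lra.
pose eta := kap * e / 8 / lam; have eta0 : 0 < eta by rewrite !divr_gt0// mulr_gt0.
have lamE : lam * (2 * p - 1 + 2 * eta) = lam * mu + kap * e / 4.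
  by rewrite /eta /mu; field; exact: lt0r_neq0.
exists kap, lam, eta; split => //; rewrite lamE.
- have := @coin_mgf_le R p (- kap); rewrite -/mu -/q => /(_ _ _)/wrap[].
  + by apply/andP; split; lra.
  + by rewrite normrN gtr0_norm// /kap; lra.
  move=> H; have : p * expR (- kap) + q * expR kap <= expR (2 * (- kap) ^+ 2 - kap * mu).
    rewrite -(ler_pM2l (expR_gt0 (kap * mu))) -[leRHS]expRD [kap * mu + _]addrC subrK.
    apply: le_trans H.
    rewrite le_eqVlt; apply/orP; left; apply/eqP; rewrite mulrDr.
    rewrite [X in X + _]mulrCA [X in _ + X]mulrCA -!expRD.
    by congr (_ * expR _ + _ * expR _); ring.
  move=> /le_trans; apply; rewrite ler_expR.
  have : 0 <= kap * (mu * p - e) by rewrite mulr_ge0 ?(ltW kap0)// subr_ge0.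
  have : 0 <= kap * e by rewrite mulr_ge0// ltW.
  have -> : 2 * (- kap) ^+ 2 = kap * e / 16 by rewrite /kap; field.
  by rewrite /lam; lra.
- have -> : p + (1 - p) * p + (1 - p) ^+ 2 * expR (2 * kap) =
      1 + q ^+ 2 * (expR (2 * kap) - 1) by rewrite /q; ring.
  have k2 : 2 * kap <= 2^-1 by rewrite /kap; lra.
  have H : 1 + q ^+ 2 * (expR (2 * kap) - 1) <=
      expR (q ^+ 2 * (2 * kap) + 8 * kap ^+ 2).
    apply: le_trans (expR_ge1Dx _); rewrite lerD2l.
    apply: (@le_trans _ _ (q ^+ 2 * (2 * kap + 8 * kap ^+ 2))).
      rewrite ler_wpM2l ?sqr_ge0//; have := expR_le_quadratic k2.
      by rewrite exprMn; lra.
    rewrite mulrDr lerD2l ger_pMl ?exprn_ile1 ?mulr_gt0 ?exprn_gt0//.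
    exact: ltW.
  apply: (le_trans (ler_wpM2l (expR_ge0 _) H)).
  rewrite -expRD ler_expR.
  have : 0 <= kap * (p * q - e) by rewrite mulr_ge0 ?(ltW kap0)// subr_ge0.
  have : 0 <= kap * e by rewrite mulr_ge0// ltW.
  have -> : 8 * kap ^+ 2 = kap * e / 4 by rewrite /kap; field.
  rewrite /lam /mu /q; nra.
Qed.

Section strategy_ae.
Context (R : realType) (d : measure_display) (T : measurableType d)
  (P : probability T R) (p : R) (b : int * nat -> T -> bool).
Hypotheses (p12 : 2^-1 < p) (p1 : p < 1).
Hypothesis Hb : bernoulli_bits P p (fun ik => (1 <= ik.2)%N) b.

(** Since [kap] is positive and h >= 0, smallness of the potential
    exp(kap h - lam F) forces the front [F] to advance at speed at least
    2 p - 1 + eta. *)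
Lemma ae_strategy_small : exists kap lam eta : R, [/\ 0 < kap, 0 < lam, 0 < eta &
  {ae P, forall w, exists C : R, forall m,
    tree_eval (b ^~ w) (strategy kap lam m 1 1 0 0) <=
    expR (C - lam * (2 * p - 1 + eta) * m%:R)}].
Proof.
have [kap [lam [eta [kap0 lam0 eta0 E1 E2]]]] := strategy_rates p12 p1.
exists kap, lam, eta; split => //.
set mu := 2 * p - 1 in E1 E2 *.
pose r : R := expR (- (lam * eta)).
pose Y (a m : nat) w := r ^+ a * expR (lam * (mu + eta) * m%:R) *
  tree_eval (b ^~ w) (strategy kap lam m 1 1 0 0).
have p01 : 0 <= p <= 1 by apply/andP; split; move: p12 p1; lra.
have ev0 m w : 0 <= tree_eval (b ^~ w) (strategy kap lam m 1 1 0 0).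
  by apply: eval_ge0; exact: leaves_ge0_strategy.
have mev m : measurable_fun setT
    (fun w => tree_eval (b ^~ w) (strategy kap lam m 1 1 0 0)).
  exact: measurable_eval Hb _.
have := @ae_bounded_of_geometric _ _ _ P Y (expR (kap - lam)) r.
case/(_ _ _ _ _ _)/wrap.
- by move=> a m; apply: measurable_funM => //; exact: measurable_cst.
- by move=> a m w; rewrite /Y !mulr_ge0 ?exprn_ge0 ?expR_ge0.
- exact: expR_ge0.
- by rewrite expR_lt1 oppr_lt0 mulr_gt0.
- move=> a m; rewrite /Y; under eq_integral do rewrite EFinM.
  rewrite ge0_integralZl//; last 3 first.
  + exact/measurable_EFinP.
  + by move=> w _; rewrite lee_fin.
  + by rewrite lee_fin mulr_ge0 ?exprn_ge0 ?expR_ge0.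
  have := @integral_tree_eval _ _ _ _ _ _ _ _ Hb [::] (strategy kap lam m 1 1 0 0).
  rewrite (_ : cylinder b [::] = setT); last by apply/seteqP.
  move=> ->//; last 2 first.
  + exact: leaves_ge0_strategy.
  + exact: reads_fresh_strategy.
  rewrite big_nil mul1r -EFinM lee_fin.
  have := mean_strategy_le m 1 1 0 0 p01 E1 E2; rewrite !mulr1 => H.
  have c0 : 0 <= r ^+ a * expR (lam * (mu + eta) * m%:R).
    by rewrite mulr_ge0 ?exprn_ge0 ?expR_ge0.
  apply: (le_trans (ler_wpM2l c0 H)).
  rewrite exprD mulrCA -!mulrA ler_wpM2l ?exprn_ge0 ?expR_ge0//.
  rewrite -expRM_natl -!expRD ler_expR.
  by rewrite le_eqVlt; apply/orP; left; apply/eqP; ring.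
apply: filterS => w [C HC].
have C0 : 0 < `|C| + 1 by rewrite ltr_wpDl.
exists (ln (`|C| + 1)) => m; rewrite expRD lnK ?posrE// expRN.
rewrite ler_pdivlMr ?expR_gt0//; have := HC 0 m.
rewrite /Y expr0 mul1r mulrC => /le_trans; apply.
by rewrite ler_wpDr// ler_norm.
Qed.

End strategy_ae.

(** * Woken sites and activation times *)

Section woken_sites.
Implicit Type x : int -> nat -> int.

(** [woken x t i] holds when a chain of walks, each taken over at a site that
    the previous one visits, leads from the origin to [i] in total time
    exactly [t]. *)
Inductive woken x : nat -> int -> Prop :=
| woken_origin : woken x 0 0
| woken_visit t i m : woken x t i -> woken x (t + m) (i + walk x i m).

Definition first_woken x (t : nat) (i : int) : Prop :=
  woken x t i /\ forall t', woken x t' i -> (t <= t')%N.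

Lemma walk0 x i : walk x i 0 = 0.
Proof. by rewrite /walk big_nil. Qed.

Lemma walkS x i n : walk x i n.+1 = walk x i n + x i n.+1.
Proof. by rewrite /walk big_nat_recr. Qed.

Lemma ex_first_woken x t i : woken x t i -> exists2 t', (t' <= t)%N & first_woken x t' i.
Proof.
move=> w; have ex : exists t, `[< woken x t i >] by exists t; exact/asboolP.
have [t' /asboolP wt' min] := ex_minnP ex.
by exists t'; [apply: min; exact/asboolP|split => // u /asboolP/min].
Qed.

Lemma first_woken_origin x : first_woken x 0 0.
Proof. by split => //; exact: woken_origin. Qed.

(** Reflection at the origin; it exchanges the two fronts. *)
Definition mirror x (i : int) (k : nat) : int := - x (- i) k.

Lemma mirrorK x : mirror (mirror x) = x.
Proof. by apply/funext => i; apply/funext => k; rewrite /mirror !opprK. Qed.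

Lemma walk_mirror x i n : walk (mirror x) i n = - walk x (- i) n.
Proof. by rewrite /walk -sumrN. Qed.

Lemma woken_mirror x t i : woken x t i -> woken (mirror x) t (- i).
Proof.
elim=> [|{}t {}i m _ ih]; first by rewrite oppr0; exact: woken_origin.
have -> : - (i + walk x i m) = - i + walk (mirror x) (- i) m.
  by rewrite walk_mirror opprK opprD.
exact: woken_visit.
Qed.

Lemma first_woken_mirror x t i : first_woken x t i -> first_woken (mirror x) t (- i).
Proof.
move=> [w m]; split; first exact: woken_mirror.
by move=> t' /woken_mirror; rewrite mirrorK opprK; exact: m.
Qed.

Section nearest_neighbour.
Variable x : int -> nat -> int.
Hypothesis pm : forall i k, (1 <= k)%N -> x i k = 1 \/ x i k = -1.

Lemma abs_walk_le i n : `|walk x i n| <= n%:Z.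
Proof.
elim: n => [|n ih]; first by rewrite walk0.
by rewrite walkS; case: (@pm i n.+1 isT) => ->; lia.
Qed.

Lemma woken_abs_le t i : woken x t i -> `|i| <= t%:Z.
Proof.
elim=> [|{}t {}i m _ ih]//; have := abs_walk_le i m.
by rewrite PoszD; lia.
Qed.

Lemma walk_ivt i n (v : int) : 0 <= v -> v <= walk x i n ->
  exists2 m, (m <= n)%N & walk x i m = v.
Proof.
move=> v0; elim: n => [|n ih].
  by rewrite walk0 => v0'; exists 0%N => //; rewrite walk0; lia.
rewrite walkS => vn; have [vle|vgt] := lerP v (walk x i n).
  by have [m mn E] := ih vle; exists m => //; exact: leqW.
exists n.+1 => //; rewrite walkS.
by case: (@pm i n.+1 isT) vn => ->; lia.
Qed.

(** Walks with steps +-1 do not jump over sites. *)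
Lemma woken_between t j i : woken x t j -> 0 <= i -> i <= j ->
  exists2 t', (t' <= t)%N & woken x t' i.
Proof.
move=> w i0; elim: w => [|{}t {}j m w ih] ij.
  by exists 0%N => //; rewrite (_ : i = 0); [exact: woken_origin|lia].
have [ij'|ji] := lerP i j.
  by have [t' tt' w'] := ih ij'; exists t' => //; exact: leq_trans (leq_addr _ _).
have [||k km E] := @walk_ivt j m (i - j); [lia|lia|].
exists (t + k)%N; first by rewrite leq_add2l.
rewrite (_ : i = j + walk x j k); first exact: woken_visit.
by rewrite E; lia.
Qed.

End nearest_neighbour.

Lemma mirror_pm x : (forall i k, (1 <= k)%N -> x i k = 1 \/ x i k = -1) ->
  forall i k, (1 <= k)%N -> mirror x i k = 1 \/ mirror x i k = -1.
Proof.
move=> pm i k k1; rewrite /mirror; case: (pm (- i) k k1) => ->; [right|left] => //.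
Qed.

End woken_sites.

Section activation.
Context (R : realType).
Implicit Type x : int -> nat -> int.

Lemma ereal_inf_nat (S : set nat) :
  ereal_inf [set (n%:R : R)%:E | n in S] = +oo%E \/
  exists2 m, S m & ereal_inf [set (n%:R : R)%:E | n in S] = (m%:R)%:E.
Proof.
have [->|/set0P[n Sn]] := eqVneq S set0.
  by left; rewrite image_set0 ereal_inf0.
right; have ex : exists n, `[< S n >] by exists n; exact/asboolP.
have [m /asboolP Sm min] := ex_minnP ex.
exists m => //; apply/eqP; rewrite eq_le; apply/andP; split.
  by apply: ereal_inf_lbound; exists m.
apply: le_ereal_inf_tmp => _ [k /asboolP Sk <-].
by rewrite lee_fin ler_nat; exact: min.
Qed.

Lemma woken_activation_le x t i : woken x t i ->
  (activation_time R x i <= t%:R%:E)%E.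
Proof.
move=> w; suff [k [y [k0 y0 yk le]]] : exists k (y : nat -> int),
    [/\ (0 < k)%N, y 0%N = 0, y k = i &
    (\sum_(1 <= l < k.+1) hitting_time R x (y l.-1) (y l) <= t%:R%:E)%E].
  by apply: le_trans le; apply: ereal_inf_lbound; exists k, y.
have hle j m : (hitting_time R x j (j + walk x j m) <= m%:R%:E)%E.
  by apply: ereal_inf_lbound; exists m.
elim: w => [|{}t {}i m _ [k [y [k0 y0 yk le]]]].
  exists 1%N, (fun=> 0); split => //; rewrite big_nat1.
  by have := hle 0 0%N; rewrite walk0 addr0.
exists k.+1, (fun l => if (l <= k)%N then y l else i + walk x i m); split => //.
- by rewrite ltnn.
- rewrite big_nat_recr//= leqnn ltnn yk natrD EFinD; apply: leeD => //.
  apply: le_trans le; rewrite le_eqVlt; apply/orP; left; apply/eqP.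
  apply: eq_big_nat => l /andP[l1]; rewrite ltnS => lk.
  by rewrite lk (leq_trans (leq_pred l) lk).
Qed.

(** Each finite term of the sum is an attained infimum of natural numbers,
    so it is the length of an actual walk. *)
Lemma chain_woken x (y : nat -> int) k : y 0%N = 0 ->
  let s := (\sum_(1 <= l < k.+1) hitting_time R x (y l.-1) (y l))%E in
  s = +oo%E \/ exists2 t, s = t%:R%:E & woken x t (y k).
Proof.
move=> y0 /=; elim: k => [|k ih].
  by right; exists 0%N; [rewrite big_nil|rewrite y0; exact: woken_origin].
rewrite big_nat_recr//=; case: ih => [->|[t -> w]].
  left; apply: addye; rewrite gt_eqF// (@lt_le_trans _ _ 0%E)// ?ltNyr//.
  by apply: le_ereal_inf_tmp => _ [m _ <-]; rewrite lee_fin.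
have := ereal_inf_nat [set n : nat | y k + walk x (y k) n = y k.+1].
rewrite -/(hitting_time R x (y k) (y k.+1)) => -[->|[m Em ->]].
  by left; rewrite addey.
right; exists (t + m)%N; first by rewrite -EFinD natrD.
by rewrite -Em; exact: woken_visit.
Qed.

Lemma activation_first x t i : first_woken x t i ->
  activation_time R x i = t%:R%:E.
Proof.
move=> [w min]; apply/eqP; rewrite eq_le woken_activation_le//=.
apply: le_ereal_inf_tmp => _ [k [y [k0 y0 yk ->]]].
have /= [->|[u -> wu]] := chain_woken x k y0; first by rewrite leey.
by rewrite lee_fin ler_nat min// -yk.
Qed.

Lemma activeP x n i :
  active R x n i <-> exists2 t, (t <= n)%N & first_woken x t i.
Proof.
split => [|[t tn ft]]; last first.
  by rewrite /active /= (activation_first ft) lee_fin ler_nat.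
have [[t w]|no] := pselect (exists t, woken x t i).
  have [u ut fu] := ex_first_woken w.
  by rewrite /active /= (activation_first fu) lee_fin ler_nat; exists u.
rewrite /active/= leNgt => /negP[]; apply: (@lt_le_trans _ _ +oo%E); first exact: ltry.
apply: le_ereal_inf_tmp => _ [k [y [k0 y0 yk ->]]].
have /= [->|[u _ wu]] := chain_woken x k y0; first by [].
by exfalso; apply: no; exists u; rewrite -yk.
Qed.

Lemma active_woken x n i :
  active R x n i <-> exists2 t, (t <= n)%N & woken x t i.
Proof.
rewrite activeP; split => -[t tn]; first by move=> [w _]; exists t.
by move=> /ex_first_woken[u ut fu]; exists u => //; exact: leq_trans tn.
Qed.

Lemma position_first x t i n : first_woken x t i -> (t <= n)%N ->
  position R x i n = i + walk x i (n - t).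
Proof.
move=> ft tn; rewrite /position (activation_first ft) lte_fin ltr_nat ltnNge tn/=.
by rewrite natrK.
Qed.

Lemma active_mirror x n i : active R (mirror x) n i <-> active R x n (- i).
Proof.
rewrite !active_woken; split => -[t tn /woken_mirror w]; exists t => //.
  by rewrite mirrorK in w.
by rewrite opprK in w.
Qed.

Lemma position_mirror x n i : active R x n i ->
  position R (mirror x) (- i) n = - position R x i n.
Proof.
move=> /activeP[t tn ft].
rewrite (position_first ft tn) (position_first (first_woken_mirror ft) tn).
by rewrite walk_mirror opprK opprD.
Qed.

Lemma active0 x n : active R x n 0.
Proof. by apply/active_woken; exists 0%N => //; exact: woken_origin. Qed.

Lemma position_woken x n i : active R x n i ->
  woken x n (position R x i n).
Proof.
move=> /activeP[t tn ft]; rewrite (position_first ft tn) -[X in woken x X _](subnKC tn).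
by apply: woken_visit; exact: ft.1.
Qed.

Lemma leftmost_mirror x n : leftmost R x n = - rightmost R (mirror x) n.
Proof.
rewrite /leftmost /rightmost /inf; congr (- sup _).
apply/seteqP; split => u /=.
  move=> [_ [i ai <-] <-]; exists (- i); last by rewrite position_mirror// rmorphN.
  by apply/active_mirror; rewrite opprK.
move=> [i /active_mirror ai <-]; exists (position R x (- i) n)%:~R; first by exists (- i).
by rewrite -rmorphN/= -position_mirror// opprK.
Qed.

Section nearest_neighbour.
Variable x : int -> nat -> int.
Hypothesis pm : forall i k, (1 <= k)%N -> x i k = 1 \/ x i k = -1.

Lemma active_between n i j : active R x n j -> 0 <= i -> i <= j -> active R x n i.
Proof.
move=> /active_woken[t tn w] i0 ij; have [u ut wu] := woken_between pm w i0 ij.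
by apply/active_woken; exists u => //; exact: leq_trans tn.
Qed.

Lemma active_abs_le n i : active R x n i -> `|i| <= n%:Z.
Proof.
move=> /active_woken[t tn /(woken_abs_le pm)] it; apply: (le_trans it).
by rewrite lez_nat.
Qed.

Let has_sup_positions n : has_sup [set ((position R x i n)%:~R : R) | i in active R x n].
Proof.
split; first by exists (position R x 0 n)%:~R, 0 => //; exact: active0.
exists n%:R => _ [i ai <-]; rewrite [leRHS]pmulrn ler_int.
have H := woken_abs_le pm (position_woken ai); apply: le_trans H; exact: ler_norm.
Qed.

Lemma position_le_rightmost n i : active R x n i ->
  (position R x i n)%:~R <= rightmost R x n.
Proof.
by move=> ai; apply: ub_le_sup; [exact: (has_sup_positions n).2|exists i].
Qed.

Lemma rightmost_near n : exists2 i, active R x n i &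
  rightmost R x n - 1 < (position R x i n)%:~R.
Proof.
have [_ [i ai <-] H] := sup_adherent (ltr01 : 0 < (1:R)) (has_sup_positions n).
by exists i.
Qed.

End nearest_neighbour.

End activation.

(** * Speeds of the fronts *)

Lemma le_of_linear_le (R : realType) (u v : R) :
  (forall eps : R, 0 < eps -> exists C : R, forall n : nat,
    v * n%:R <= (u + eps) * n%:R + C) -> v <= u.
Proof.
move=> H; rewrite leNgt; apply/negP => uv.
have e0 : 0 < (v - u) / 2 by rewrite divr_gt0// subr_gt0.
have [C HC] := H _ e0.
have := HC (Num.truncn (C / ((v - u) / 2))).+1.
set n := (Num.truncn _).+1 => Hn.
have : C < (v - u) / 2 * n%:R by rewrite mulrC -ltr_pdivrMr// truncnS_gt.
by move: Hn; lra.
Qed.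

(** The additive constant absorbs the finitely many times before the
    asymptotic regime; thus the bound can be used at the random times at which
    sites are woken. *)
Lemma linear_growth_bound (R : realType) (u : nat -> R) (v : R) :
  u n / n%:R @[n --> \oo] --> v ->
  forall eps : R, 0 < eps -> exists2 C : R, 0 <= C &
    forall n, `|u n - v * n%:R| <= eps * n%:R + C.
Proof.
move=> uv eps e0; have /cvgrPdist_le /(_ eps e0) [N _ HN] := uv.
exists (\sum_(n < N.+1) `|u n - v * n%:R|); first by apply: sumr_ge0.
move=> n; have [nN|Nn] := leqP n N.
  rewrite (bigD1 (Ordinal (nN : (n < N.+1)%N)))//= addrCA lerDl addr_ge0//.
    by rewrite mulr_ge0// ltW.
  exact: sumr_ge0.
apply: (@le_trans _ _ (eps * n%:R)); last by rewrite lerDl sumr_ge0.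
have n0 : 0 < n%:R :> R by rewrite ltr0n (leq_ltn_trans _ Nn).
have := HN n (ltnW Nn); rewrite /= distrC -(ler_pM2r n0).
by rewrite -[X in _ * X](gtr0_norm n0) -normrM mulrBl divfK ?gt_eqF// gtr0_norm.
Qed.

Section fronts.
Context (R : realType) (x : int -> nat -> int).
Hypothesis pm : forall i k, (1 <= k)%N -> x i k = 1 \/ x i k = -1.
Variable v : R.
Hypothesis right_speed : rightmost R x n / n%:R @[n --> \oo] --> v.

(** When it is woken, a site carries its own frog, so it is at most the
    rightmost position at that time.  The maximum with 0 is there because
    sites remain woken when the front recedes. *)
Lemma active_le_speed (eps : R) : 0 < eps -> exists2 C : R, 0 <= C &
  forall n i, active R x n i -> i%:~R <= (Num.max v 0 + eps) * n%:R + C.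
Proof.
move=> e0; have [C C0 HC] := linear_growth_bound right_speed e0; exists C => //.
move=> n i /activeP[t tn ft]; have ai : active R x t i by apply/activeP; exists t.
have := position_le_rightmost pm ai.
rewrite (position_first _ ft (leqnn t)) subnn walk0 addr0 => it.
have := HC t; rewrite ler_norml => /andP[_ Ht].
have tn' : t%:R <= n%:R :> R by rewrite ler_nat.
have v0 : v <= Num.max v 0 by rewrite le_max lexx.
have m0 : 0 <= Num.max v 0 by rewrite le_max lexx orbT.
have : v * t%:R <= Num.max v 0 * n%:R.
  apply: (@le_trans _ _ (Num.max v 0 * t%:R)); first by rewrite ler_wpM2r.
  by rewrite ler_wpM2l.
have : eps * t%:R <= eps * n%:R by rewrite ler_wpM2l// ltW.
by move: Ht it; lra.
Qed.

(** A site carrying an active frog is woken, and so are the sites between it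
    and the origin. *)
Lemma active_of_le_speed (eps : R) : 0 < eps -> exists2 C : R, 0 <= C &
  forall n (i : int), 0 <= i -> i%:~R <= (Num.max v 0 - eps) * n%:R - C -> active R x n i.
Proof.
move=> e0; have [C C0 HC] := linear_growth_bound right_speed e0.
exists (C + 1); first by rewrite addr_ge0.
move=> n i i0 iv; have n0 : 0 <= n%:R :> R by [].
have ir0 : 0 <= i%:~R :> R by rewrite ler0z.
have en : 0 <= eps * n%:R by rewrite mulr_ge0// ltW.
have [v0|v0] := leP 0 v; last first.
  by exfalso; move: iv; rewrite (max_r (ltW v0)); lra.
have := HC n; rewrite ler_norml => /andP[Hn _].
have [j aj Hj] := @rightmost_near R x pm n.
rewrite max_l// in iv.
have ij : i <= position R x j n.
  rewrite -(ler_int R); move: Hn Hj iv; lra.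
apply/active_woken; have [t tn w] := woken_between pm (position_woken aj) i0 ij.
by exists t.
Qed.

(** Site [i] is woken at time [t] but not at time [t - 1], which locates it
    between the two previous bounds. *)
Lemma first_woken_speed (eps : R) : 0 < v -> 0 < eps -> exists2 C : R, 0 <= C &
  forall t (i : int), 0 <= i -> first_woken x t i ->
    `|i%:~R - v * t%:R| <= eps * t%:R + C.
Proof.
move=> v0 e0; have [C1 C10 H1] := active_le_speed e0.
have [C2 C20 H2] := active_of_le_speed e0.
rewrite (max_l (ltW v0)) in H1 H2.
(* The last constant pays for comparing time [t] with time [t - 1]. *)
exists (C1 + C2 + `|v - eps|); first by rewrite !addr_ge0.
move=> t i i0 ft; have ti : i%:~R <= (v + eps) * t%:R + C1.
  by apply: H1; apply/activeP; exists t.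
have nv := ler_norm (v - eps).
have nv0 : 0 <= `|v - eps| by [].
rewrite ler_norml; apply/andP; split; last by move: ti; lra.
case: t ft ti => [|t] ft ti.
  by rewrite !mulr0 subr0; have : 0 <= i%:~R :> R; [rewrite ler0z|lra].
have [ti'|] := lerP i%:~R ((v - eps) * t%:R - C2).
  have /active_woken[u ut wu] := H2 _ _ i0 ti'.
  by have := ft.2 _ wu; rewrite leqNgt ltnS ut.
by rewrite -natr1; lra.
Qed.

Variable mu : R.
Hypothesis lln : forall eps : R, 0 < eps -> exists C : R, forall i m,
  `|(walk x i m)%:~R - mu * m%:R| <= eps * (`|i|%N + m)%:R + C.

Lemma lln_active (eps : R) : 0 < eps -> exists C : R, forall n t i, (t <= n)%N ->
  first_woken x t i ->
  `|(position R x i n)%:~R - (i%:~R + mu * (n%:R - t%:R))| <= eps * n%:R + C.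
Proof.
move=> e0; have e2 : 0 < eps / 2 by rewrite divr_gt0.
have [C HC] := lln e2; exists C => n t i tn ft.
rewrite (position_first _ ft tn) rmorphD/= -natrB//.
have -> (a b c : R) : a + b - (a + c) = b - c by ring.
apply: le_trans (HC i (n - t)%N) _; rewrite lerD2r.
apply: (@le_trans _ _ (eps / 2 * (n + n)%:R)); last by rewrite natrD; lra.
rewrite ler_wpM2l ?(ltW e2)// ler_nat leq_add ?leq_subr//.
by rewrite -lez_nat abszE (le_trans (woken_abs_le pm ft.1))// lez_nat.
Qed.

(** Frog [i] is near i + mu (n - t) with t its activation time, and t is
    near i / v; here mu / v times the error in i - v t is still small. *)
Lemma position_ge0_speed (eps : R) : 0 <= mu -> 0 < v -> 0 < eps ->
  exists C : R, forall n (i : int), 0 <= i -> active R x n i ->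
  `|(position R x i n)%:~R - (mu * n%:R + i%:~R * (1 - mu / v))| <= eps * n%:R + C.
Proof.
move=> mu0 v0 e0; have e2 : 0 < eps / 2 by rewrite divr_gt0.
have [C1 H1] := lln_active e2.
pose k := mu / v; have k0 : 0 <= k by rewrite divr_ge0// ltW.
have e3 : 0 < eps / (2 * (1 + k)) by rewrite divr_gt0// mulr_gt0// ltr_wpDr.
have [C2 C20 H2] := first_woken_speed v0 e3.
exists (C1 + k * C2) => n i i0 /activeP[t tn ft].
have {}H1 := H1 n t i tn ft; have {}H2 := H2 t i i0 ft.
rewrite -/k (_ : _ - _ = ((position R x i n)%:~R - (i%:~R + mu * (n%:R - t%:R))) +
    k * (i%:~R - v * t%:R)); last by rewrite /k; field; exact: lt0r_neq0.
apply: (le_trans (ler_normD _ _)); rewrite normrM (ger0_norm k0).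
have {}H2 := ler_wpM2l k0 H2.
have ke : k * (eps / (2 * (1 + k))) <= eps / 2.
  rewrite [X in _ <= X](_ : _ = (1 + k) * (eps / (2 * (1 + k)))).
    by rewrite ler_wpM2r ?(ltW e3)// lerDr.
  by field; rewrite gt_eqF// ltr_wpDr.
have : k * (eps / (2 * (1 + k))) * t%:R <= eps / 2 * n%:R.
  apply: ler_pM; rewrite ?ler_nat//.
  by rewrite mulr_ge0// ltW.
by move: H1 H2; rewrite mulrDr mulrA; lra.
Qed.

Lemma position_sup_speed (eps : R) : 0 < eps -> exists C : R, forall n,
  (position R x 0 n)%:~R <= (mu + eps) * n%:R + C.
Proof.
move=> e0; have [C HC] := lln_active e0; exists C => n.
have := HC n 0%N 0 (leq0n n) (first_woken_origin x).
by rewrite subr0 add0r ler_norml => /andP[_]; lra.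
Qed.

End fronts.

Section drift_on_the_left.
Context (R : realType) (x : int -> nat -> int).
Hypothesis pm : forall i k, (1 <= k)%N -> x i k = 1 \/ x i k = -1.
Variable mu : R.
Hypothesis lln : forall eps : R, 0 < eps -> exists C : R, forall i m,
  `|(walk x i m)%:~R - mu * m%:R| <= eps * (`|i|%N + m)%:R + C.
Variable vmin : R.
Hypothesis left_speed : leftmost R x n / n%:R @[n --> \oo] --> vmin.

Lemma mirror_speed : rightmost R (mirror x) n / n%:R @[n --> \oo] --> - vmin.
Proof.
rewrite (_ : (fun n => _) = (fun n => - (leftmost R x n / n%:R))).
  exact: cvgN left_speed.
by apply/funext => n; rewrite leftmost_mirror mulNr opprK.
Qed.

Lemma leftmost_le_position n i : active R x n i ->
  leftmost R x n <= (position R x i n)%:~R.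
Proof.
move=> ai; rewrite leftmost_mirror lerNl -rmorphN/= -position_mirror//.
apply: position_le_rightmost; first exact: mirror_pm.
by apply/active_mirror; rewrite opprK.
Qed.

Lemma leftmost_near n : exists2 i, active R x n i &
  (position R x i n)%:~R < leftmost R x n + 1.
Proof.
have [j aj Hj] := rightmost_near R (mirror_pm pm) n.
exists (- j); first exact/active_mirror.
rewrite leftmost_mirror; move: Hj; rewrite -[in position R (mirror x) j n](opprK j).
by rewrite position_mirror ?rmorphN/=; [lra|exact/active_mirror].
Qed.

(** Frog 0 moves at speed [mu] and is never to the left of the leftmost
    frog. *)
Lemma left_speed_le_drift : vmin <= mu.
Proof.
apply: le_of_linear_le => eps e0; have e2 : 0 < eps / 2 by rewrite divr_gt0.
have [C1 C10 H1] := linear_growth_bound left_speed e2.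
have [C2 H2] := position_sup_speed pm lln e2.
exists (C1 + C2) => n; have := H1 n; rewrite ler_norml => /andP[H _].
have := leftmost_le_position (active0 R x n); have := H2 n.
by move: H; lra.
Qed.

(** If no frog with label at least 0 goes below 0, then no negative site is
    ever woken, and every active frog has a position near
    mu n + i (1 - mu / v) with i >= 0, hence at least mu n - o(n). *)
Lemma drift_le_left_speed (v : R) :
  rightmost R x n / n%:R @[n --> \oo] --> v -> 0 < v -> 0 <= mu -> mu <= v ->
  (forall a m : nat, 0 <= a%:Z + walk x a m) -> mu <= vmin.
Proof.
move=> right_speed v0 mu0 muv noleft.
have act0 n i : active R x n i -> 0 <= i.
  move=> /active_woken[t _]; elim=> [//|{}t {}i m _].
  by case: i => // a _; exact: noleft.
apply: le_of_linear_le => eps e0; have e2 : 0 < eps / 2 by rewrite divr_gt0.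
have [C1 C10 H1] := linear_growth_bound left_speed e2.
have [C2 H2] := position_ge0_speed pm right_speed lln mu0 v0 e2.
exists (C1 + C2 + 1) => n; have := H1 n; rewrite ler_norml => /andP[_ H].
have [i ai Hi] := leftmost_near n.
have := H2 n i (act0 _ _ ai) ai; rewrite ler_norml => /andP[K _].
have : 0 <= i%:~R * (1 - mu / v).
  by rewrite mulr_ge0 ?ler0z ?(act0 _ _ ai)// subr_ge0 ler_pdivrMr// mul1r.
by move: H K Hi; lra.
Qed.

End drift_on_the_left.

(** * Active frogs are evenly spread *)

Section strategy_reaches.
Context (R : realType) (kap lam : R) (x : int -> nat -> int).
Variable bit : int * nat -> bool.
Hypothesis kap0 : 0 <= kap.
Hypothesis xbit : forall i k, (1 <= k)%N -> x i k = if bit (i, k) then 1 else -1.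

(** Along the strategy the followed frog is a genuine active frog: its
    activation time plus its age never exceeds the elapsed time. *)
Lemma strategy_wakes n (F h c a N T : nat) :
  woken x T c -> (T + a <= N)%N -> c%:Z + walk x c a = F%:Z - h%:Z ->
  (exists2 t, (t <= N)%N & woken x t (F%:Z - 1)) ->
  exists2 F' : nat, expR (- (lam * F'%:R)) <= tree_eval bit (strategy kap lam n F h c a) &
    exists2 t, (t <= N + n)%N & woken x t (F'%:Z - 1).
Proof.
elim: n F h c a N T => [|n ih] F h c a N T wc TN cF wF /=.
  exists F; last by rewrite addn0.
  by rewrite ler_expR addrC lerDl mulr_ge0.
rewrite addnS -addSn.
have TN1 : (T + a.+1 <= N.+1)%N by rewrite addnS ltnS.
have wF1 : exists2 t, (t <= N.+1)%N & woken x t (F%:Z - 1).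
  by have [t tN w] := wF; exists t => //; exact: leqW.
have step : c%:Z + walk x c a.+1 =
    F%:Z - h%:Z + (if bit (Posz c, a.+1) then 1 else -1).
  by rewrite walkS addrA cF xbit.
case: h cF step => [|h] cF step; last first.
  rewrite /=; case: (bit _) step => step; apply: ih wc TN1 _ wF1; rewrite step; lia.
have wFF : woken x (T + a) F.
  by rewrite (_ : Posz F = c%:Z + walk x c a); [exact: woken_visit|rewrite cF; lia].
have wFF1 : exists2 t, (t <= N.+1)%N & woken x t (F.+1%:Z - 1).
  by exists (T + a)%N; [exact: leqW|rewrite (_ : _ - _ = F%:Z)//; lia].
rewrite /=; case: (boolP (bit (Posz F, 1%N))) => bF.
  apply: (ih F.+1 0%N F 1%N N.+1 (T + a)%N) => //; first by rewrite addn1 ltnS.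
  by rewrite walkS walk0 xbit// bF; lia.
rewrite /=; case: (bit _) step => step; apply: ih wc TN1 _ wFF1; rewrite step; lia.
Qed.

Hypothesis lam0 : 0 < lam.

Lemma strategy_speed (w v : R) :
  rightmost R x n / n%:R @[n --> \oo] --> v -> 0 < v ->
  (exists C : R, forall m,
    tree_eval bit (strategy kap lam m 1 1 0 0) <= expR (C - lam * w * m%:R)) ->
  w <= v.
Proof.
move=> right_speed v0 [C HC].
have pm i k : (1 <= k)%N -> x i k = 1 \/ x i k = -1.
  by move=> k1; rewrite xbit//; case: (bit _); [left|right].
apply: le_of_linear_le => eps e0.
have [C1 C10 H1] := active_le_speed pm right_speed e0.
rewrite (max_l (ltW v0)) in H1.
exists (C1 + 1 + C / lam) => m.
have [||||F HF [t tm wF]] := @strategy_wakes m 1 1 0 0 0 0.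
- exact: woken_origin.
- by [].
- by rewrite walk0.
- by exists 0%N => //; exact: woken_origin.
have /H1 : active R x m (F%:Z - 1) by apply/active_woken; exists t.
have := le_trans HF (HC m); rewrite ler_expR => {}HF.
have {}HF : w * m%:R - C / lam <= F%:R.
  rewrite -(ler_pM2l lam0) (_ : lam * _ = lam * w * m%:R - C); first by lra.
  by field; rewrite gt_eqF.
by rewrite rmorphB/=; move: HF; lra.
Qed.

End strategy_reaches.

Section uniform_positions.
Context (R : realType) (x : int -> nat -> int).
Hypothesis pm : forall i k, (1 <= k)%N -> x i k = 1 \/ x i k = -1.

Definition active_range (n l r : nat) : Prop :=
  forall i, active R x n i <-> - l%:Z <= i <= r%:Z.

(** The woken sites are within distance n of the origin, contain it, and
    have no gaps. *)
Lemma ex_active_range n : exists l r, active_range n l r.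
Proof.
have extent (s : int) : exists2 l : nat, active R x n (s * l%:Z) &
    forall k : nat, active R x n (s * k%:Z) -> `|s| = 1 -> (k <= l)%N.
  pose A k := `[< active R x n (s * k%:Z) /\ `|s| = 1 >].
  have [s1|s1] := eqVneq `|s| 1; last first.
    by exists 0%N => [|k _ E]; [rewrite mulr0; exact: active0|rewrite E eqxx in s1].
  have exA : exists k, A k by exists 0%N; apply/asboolP; rewrite mulr0; split => //; exact: active0.
  have ubA k : A k -> (k <= n)%N.
    by move=> /asboolP[/(active_abs_le pm)]; rewrite normrM s1 mul1r lez_nat.
  have [l /asboolP[al _] max] := ex_maxnP exA ubA.
  by exists l => // k ak _; apply: max; exact/asboolP.
have [l al maxl] := extent (-1); have [r ar maxr] := extent 1.
exists l, r => i; split => [ai|/andP[li ir]].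
  have [i0|i0] := lerP 0 i.
    by have := maxr `|i|%N; rewrite mul1r gez0_abs// => /(_ ai erefl); lia.
  by have := maxl `|i|%N; rewrite mulN1r ltz0_abs// opprK => /(_ ai erefl); lia.
have [i0|i0] := lerP 0 i.
  by apply: active_between ar i0 _ => //; rewrite mul1r.
rewrite -[i]opprK; apply/active_mirror; apply: (active_between (mirror_pm pm) (j := l%:Z)).
- by apply/active_mirror; rewrite -mulN1r.
- lia.
- lia.
Qed.

Lemma active_range_mirror n l r : active_range n l r ->
  forall i, active R (mirror x) n i <-> - r%:Z <= i <= l%:Z.
Proof. by move=> H i; rewrite active_mirror H; lia. Qed.

End uniform_positions.

(** Site [r] is woken and site [r + 1] is not. *)
Lemma active_range_right_speed (R : realType) x v :
  (forall i k, (1 <= k)%N -> x i k = 1 \/ x i k = -1) ->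
  rightmost R x n / n%:R @[n --> \oo] --> v ->
  forall eps : R, 0 < eps -> exists C : R, forall n l r, active_range R x n l r ->
    `|r%:R - Num.max v 0 * n%:R| <= eps * n%:R + C.
Proof.
move=> pm right_speed eps e0.
have [C1 C10 H1] := active_le_speed pm right_speed e0.
have [C2 C20 H2] := active_of_le_speed pm right_speed e0.
exists (C1 + C2 + 1) => n l r rng.
have /H1 Hr : active R x n r by apply/rng; lia.
have nr : ~ active R x n r.+1 by move/rng; lia.
have Hr' : (Num.max v 0 - eps) * n%:R - C2 < r.+1%:R.
  rewrite ltNge; apply/negP => H; apply: nr; apply: H2 => //.
by rewrite -natr1 in Hr'; rewrite ler_norml; apply/andP; split; move: Hr Hr'; lra.
Qed.

Lemma range_index_bounds (R : realType) (i : int) (l r : nat) : - l%:Z <= i <= r%:Z ->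
  0 <= (i + l%:Z)%:~R :> R /\ (i + l%:Z)%:~R <= (l + r).+1%:R :> R.
Proof.
move=> ilr; split; first by rewrite ler0z; lia.
by rewrite [leRHS]pmulrn ler_int; lia.
Qed.

Section rescaled_positions.
Context (R : realType) (x : int -> nat -> int).
Hypothesis pm : forall i k, (1 <= k)%N -> x i k = 1 \/ x i k = -1.
Variables (mu vmin vmax : R).
Hypothesis lln : forall eps : R, 0 < eps -> exists C : R, forall i m,
  `|(walk x i m)%:~R - mu * m%:R| <= eps * (`|i|%N + m)%:R + C.
Hypothesis right_speed : rightmost R x n / n%:R @[n --> \oo] --> vmax.
Hypothesis left_speed : leftmost R x n / n%:R @[n --> \oo] --> vmin.
Hypothesis vmax0 : 0 < vmax.
Hypothesis speeds : (mu = 0 /\ vmin <= 0) \/ [/\ 0 < mu, vmin = mu & mu < vmax].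

(** For negative labels the formula holds for a different reason than for
    the others.  If [mu = 0], each frog stays near its label at all times.  If
    [mu > 0], only labels of size o(n) are active; their frogs are near mu n,
    at least because vmin = mu and at most because no frog moves faster than
    its drift, up to o(n). *)
Lemma position_profile (eps : R) : 0 < eps -> exists C : R, forall n i,
  active R x n i ->
  `|(position R x i n)%:~R - (mu * n%:R + i%:~R * (1 - mu / vmax))| <= eps * n%:R + C.
Proof.
move=> e0; case: speeds => [[mu0 _]|[mu0 vminE muv]].
  have [C HC] := lln_active pm lln e0; exists C => n i /activeP[t tn ft].
  have := HC n t i tn ft; rewrite mu0 !mul0r subr0 mulr1 addr0 add0r.
  by [].
have e2 : 0 < eps / 2 by rewrite divr_gt0.
have [C1 H1] := position_ge0_speed pm right_speed lln (ltW mu0) vmax0 e2.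
have [C2 H2] := lln_active pm lln e2.
have [C3 C30 H3] := linear_growth_bound left_speed e2.
have [C4 C40 H4] := active_le_speed (mirror_pm pm) (mirror_speed left_speed) e2.
exists (`|C1| + `|C2| + C3 + C4) => n i ai.
have n0 : 0 <= n%:R :> R by [].
have en : 0 <= eps * n%:R by rewrite mulr_ge0// ltW.
have nC1 := ler_norm C1; have nC2 := ler_norm C2.
have nC10 : 0 <= `|C1| by []. have nC20 : 0 <= `|C2| by [].
have [i0|i0] := lerP 0 i.
  by apply: (le_trans (H1 _ _ i0 ai)); lra.
have ir0 : i%:~R < 0 :> R by rewrite ltrz0.
have /activeP[t tn ft] := ai.
have := H2 n t i tn ft; rewrite ler_norml => /andP[_ K2].
have := H3 n; rewrite ler_norml => /andP[K3 _].
have K := leftmost_le_position pm ai.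
have /H4 : active R (mirror x) n (- i) by apply/active_mirror; rewrite opprK.
rewrite vminE max_r ?oppr_le0 ?(ltW mu0)// add0r rmorphN/= => K4.
have mut : 0 <= mu * t%:R by rewrite mulr_ge0// ltW.
pose k := mu / vmax; have k0 : 0 <= k by rewrite divr_ge0// ltW.
have k1 : k <= 1 by rewrite ler_pdivrMr// mul1r ltW.
have ik : i%:~R <= i%:~R * (1 - k) :> R.
  by have := mulr_le0_ge0 (ltW ir0) k0; rewrite mulrBr mulr1; lra.
have ik' : i%:~R * (1 - k) <= 0 :> R by rewrite mulr_le0_ge0 ?subr_ge0// ltW.
rewrite vminE in K3; rewrite -/k.
by rewrite ler_norml; apply/andP; split; move: K K2 K3 K4 ik ik'; lra.
Qed.

(** The affine profile maps the woken interval, asymptotically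
    [- a n, vmax n] with a = max(- vmin, 0), onto [vmin n, vmax n]; this is
    where the relation between the speeds and the drift is used. *)
Lemma rescaled_position_near_uniform (eps : R) : 0 < eps ->
  \forall n \near \oo, forall l r, active_range R x n l r -> forall i,
    - l%:Z <= i <= r%:Z ->
    `|rescaled_position vmin vmax x n i - (i + l%:Z)%:~R / (l + r).+1%:R| <= eps.
Proof.
move=> e0; pose a := Num.max (- vmin) 0.
have a0 : 0 <= a by rewrite le_max lexx orbT.
pose V := vmax + a; have V0 : 0 < V by rewrite ltr_wpDr.
pose D := vmax - vmin.
have D0 : 0 < D.
  by rewrite subr_gt0; case: speeds => [[_ /le_lt_trans]|[_ ->]//]; exact.
(* The errors [T1], [T2], [T3] below are at most 2 del / D, 2 del / V and
   6 del / V, which add up to eps. *)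
pose del := eps / (2 * (D^-1 + 4 / V)).
have DV0 : 0 < D^-1 + 4 / V by rewrite addr_gt0 ?divr_gt0 ?invr_gt0.
have del0 : 0 < del by rewrite divr_gt0// mulr_gt0.
have [C1 H1] := position_profile del0.
have [C2 H2] := active_range_right_speed pm right_speed del0.
have [C3 H3] := active_range_right_speed (mirror_pm pm) (mirror_speed left_speed) del0.
pose C := `|C1| + `|C2| + `|C3| + 1.
near=> n => l r rng i ilr.
have n0 : 0 < n%:R :> R by rewrite ltr0n; near: n; exists 1%N.
have Cn : C <= del * n%:R.
  rewrite mulrC -ler_pdivrMr//; near: n; exists (Num.truncn (C / del)).+1 => // m /= Hm.
  by apply: (le_trans (ltW (truncnS_gt _))); rewrite ler_nat.
have nC1 := ler_norm C1; have nC2 := ler_norm C2; have nC3 := ler_norm C3.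
have nC10 : 0 <= `|C1| by []. have nC20 : 0 <= `|C2| by []. have nC30 : 0 <= `|C3| by [].
have ai : active R x n i by apply/rng.
have {}H1 : `|(position R x i n)%:~R - (mu * n%:R + i%:~R * (1 - mu / vmax))| <=
    2 * del * n%:R.
  by apply: (le_trans (H1 n i ai)); move: Cn; rewrite /C; lra.
have {}H2 : `|r%:R - vmax * n%:R| <= 2 * del * n%:R.
  have := H2 _ _ _ rng; rewrite (max_l (ltW vmax0)) => /le_trans; apply.
  by move: Cn; rewrite /C; lra.
have {}H3 : `|l%:R - a * n%:R| <= 2 * del * n%:R.
  have := H3 n r l (active_range_mirror rng) => /le_trans; apply.
  by move: Cn; rewrite /C; lra.
pose N : R := (l + r).+1%:R; have N0 : 0 < N by rewrite ltr0n.
have NE : N = l%:R + r%:R + 1 by rewrite /N -natr1 natrD.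
have [k0 kN] := range_index_bounds R ilr; rewrite -/N in kN.
pose k : R := (i + l%:Z)%:~R; rewrite -/k -/N.
have kE : k = i%:~R + l%:R by rewrite /k rmorphD.
have zE : rescaled_position vmin vmax x n i =
   ((position R x i n)%:~R - (mu * n%:R + i%:~R * (1 - mu / vmax))) / (D * n%:R) +
   (i%:~R + a * n%:R) / (V * n%:R).
  rewrite /rescaled_position -/D.
  have -> : (i%:~R + a * n%:R) / (V * n%:R) =
     (mu * n%:R + i%:~R * (1 - mu / vmax) - vmin * n%:R) / (D * n%:R).
    have n00 : n%:R != 0 :> R by rewrite gt_eqF.
    have vm0 : vmax != 0 by rewrite gt_eqF.
    case: speeds => [[mu0 vmin0]|[mu0 vminE muv]].
      rewrite /V /a mu0 max_l ?oppr_ge0// -/D mul0r mul0r subr0 mulr1 add0r.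
      by rewrite mulNr.
    have vmu : vmax - mu != 0 by rewrite subr_eq0 gt_eqF.
    rewrite /V /D /a vminE max_r ?oppr_le0 ?(ltW mu0)// addr0.
    by field; rewrite n00 vm0 vmu.
  by rewrite -mulrDl; congr (_ / _); ring.
have -> : rescaled_position vmin vmax x n i - k / N =
   ((position R x i n)%:~R - (mu * n%:R + i%:~R * (1 - mu / vmax))) / (D * n%:R) -
   (l%:R - a * n%:R) / (V * n%:R) + (k / N) * ((N - V * n%:R) / (V * n%:R)).
  rewrite zE kE; field; rewrite !gt_eqF//.
have T1 : `|((position R x i n)%:~R - (mu * n%:R + i%:~R * (1 - mu / vmax))) / (D * n%:R)|
    <= 2 * del / D.
  rewrite normrM [X in _ * X]gtr0_norm ?invr_gt0 ?mulr_gt0//.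
  rewrite ler_pdivrMr ?mulr_gt0// (_ : 2 * del / D * (D * n%:R) = 2 * del * n%:R)//.
  by field; rewrite gt_eqF.
have T2 : `|(l%:R - a * n%:R) / (V * n%:R)| <= 2 * del / V.
  rewrite normrM [X in _ * X]gtr0_norm ?invr_gt0 ?mulr_gt0//.
  rewrite ler_pdivrMr ?mulr_gt0// (_ : 2 * del / V * (V * n%:R) = 2 * del * n%:R)//.
  by field; rewrite gt_eqF.
have T3 : `|(k / N) * ((N - V * n%:R) / (V * n%:R))| <= 6 * del / V.
  rewrite normrM -[leRHS]mul1r; apply: ler_pM => //.
    by rewrite ger0_norm ?divr_ge0// ?(ltW N0)// ler_pdivrMr// mul1r.
  rewrite normrM [X in _ * X]gtr0_norm ?invr_gt0 ?mulr_gt0//.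
  rewrite ler_pdivrMr ?mulr_gt0// (_ : 6 * del / V * (V * n%:R) = 6 * del * n%:R); last first.
    by field; rewrite gt_eqF.
  move: H2 H3 Cn; rewrite NE /V /C !ler_norml => /andP[? ?] /andP[? ?] ?.
  by apply/andP; split; lra.
have -> : eps = 2 * del / D + 8 * del / V.
  by rewrite /del; field; rewrite !gt_eqF//=; lra.
apply: (le_trans (ler_normD _ _)); rewrite (_ : 8 * del / V = 2 * del / V + 6 * del / V).
  rewrite addrA lerD// (le_trans (ler_normB _ _))// lerD//.
by field; rewrite gt_eqF.
Unshelve. all: by end_near. Qed.

End rescaled_positions.

(** * Riemann sums *)

Section riemann.
Context (R : realType).
Local Notation leb := (@lebesgue_measure R).

(** Heine-Cantor: near each point of the compact interval one radius works,
    and compactness makes the choice of the radius uniform. *)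
Lemma uniform_continuity01 (f : R -> R) : {within `[0, 1], continuous f} ->
  forall eps : R, 0 < eps -> exists2 del : R, 0 < del &
    forall s t, 0 <= s <= 1 -> 0 <= t <= 1 -> `|s - t| <= del -> `|f s - f t| <= eps.
Proof.
move=> cf eps e0; have e2 : 0 < eps / 2 by rewrite divr_gt0.
have [/(_ (@segment_compact R 0 1)) + _] := compact_near_coveringP (`[0, 1]%classic : set R).
move=> /near_covering_withinP/(_ R (0^'+)
  (fun del s => forall t, `[0, 1]%classic t -> `|s - t| <= del -> `|f s - f t| <= eps)).
case/(_ _ _)/wrap => [x x01|].
  have /cvgrPdist_le/(_ _ e2) Hx := cf x.
  have : within `[0, 1]%classic (nbhs x) (fun t => `|f x - f t| <= eps / 2).
    by rewrite nbhs_subspace_in//; exact: Hx.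
  move=> /nbhs_ballP[del /= del0 Hdel].
  near=> s d => s01 t t01 std.
  have H (u : R) : `[0, 1]%classic u -> `|x - u| < del -> `|f x - f u| <= eps / 2.
    by move=> u01 xu; apply: Hdel.
  have xs : `|x - s| < del / 2.
    near: s; apply/nbhs_ballP; exists (del / 2); first by rewrite /= divr_gt0.
    by [].
  have dd : d < del / 2.
    by near: d; apply: nbhs_right_lt; rewrite divr_gt0.
  have := H s s01; have := H t t01.
  have -> : f s - f t = (f x - f t) - (f x - f s) by ring.
  move=> Ht Hs; apply: (le_trans (ler_normB _ _)).
  rewrite [eps]splitr lerD//; first apply: Ht; last apply: Hs.
    rewrite (_ : x - t = (x - s) + (s - t)); last by ring.
    apply: (le_lt_trans (ler_normD _ _)); rewrite [ltRHS]splitr.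
    exact: ltr_leD xs (le_trans std (ltW dd)).
  by apply: lt_trans xs _; rewrite ltr_pdivrMr// mulr_natr mulr2n ltrDl.
move=> H; have [d [d0 Hd]] : exists d : R, 0 < d /\
    (`[0, 1]%classic `<=` (fun s => forall t, `[0, 1]%classic t -> `|s - t| <= d ->
       `|f s - f t| <= eps)).
  by near (0 : R)^'+ => d; exists d; split; [near: d; exact: nbhs_right_gt|near: d; exact: H].
by exists d => // s t s01 t01; apply: Hd; rewrite /= in_itv.
Unshelve. all: by end_near. Qed.

Lemma step_error_add (I0 I1 Ik S D c e h : R) : `|I0 - h * S| <= h * D ->
  I1 - I0 = Ik -> Ik <= (c + e) * h -> (c - e) * h <= Ik ->
  `|I1 - h * (S + c)| <= h * (D + e).
Proof.
move=> + <-; rewrite !ler_norml => /andP[? ?] ? ?.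
by apply/andP; split; lra.
Qed.

(** Cells are open on the left, so that the integral over [0, (j + 1) / N]
    splits at j / N. *)
Lemma Rintegral_step_approx (f : R -> R) (N : nat) (c del : nat -> R) : (0 < N)%N ->
  leb.-integrable `[0, 1] (EFin \o f) ->
  (forall j, (j < N)%N -> forall t, j%:R / N%:R < t -> t <= j.+1%:R / N%:R ->
     `|f t - c j| <= del j) ->
  `|(\int[leb]_(t in `[0, 1]) f t)%R - N%:R^-1 * \sum_(j < N) c j| <=
    N%:R^-1 * \sum_(j < N) del j.
Proof.
move=> N0 intf Hf; have N0r : 0 < N%:R :> R by rewrite ltr0n.
have sub (k : nat) : (k <= N)%N -> `[0, k%:R / N%:R]%classic `<=` `[0, 1 : R]%classic.
  move=> kN; apply: subset_itvl; rewrite bnd_simp ler_pdivrMr// mul1r ler_nat//.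
have step k : (k <= N)%N ->
  `|(\int[leb]_(t in `[0, k%:R / N%:R]) f t)%R - N%:R^-1 * \sum_(j < k) c j| <=
    N%:R^-1 * \sum_(j < k) del j.
  elim: k => [_|k ih kN].
    by rewrite mul0r set_itv1 Rintegral_set1 !big_ord0 mulr0 subr0 normr0.
  have {}ih := ih (ltnW kN).
  have kk1 : k%:R / N%:R <= k.+1%:R / N%:R :> R by rewrite ler_pM2r ?invr_gt0// ler_nat.
  have i1 : leb.-integrable `[0, k.+1%:R / N%:R] (EFin \o f).
    by apply: integrableS intf => //; exact: sub.
  have := @Rintegral_itvB R f (BLeft 0) (BRight (k.+1%:R / N%:R)) (k%:R / N%:R) i1.
  rewrite !bnd_simp divr_ge0// => /(_ isT kk1) E.
  have i2 : leb.-integrable `]k%:R / N%:R, k.+1%:R / N%:R] (EFin \o f).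
    apply: integrableS i1 => //; apply: subset_itvr; rewrite bnd_simp divr_ge0//.
  have len : fine (leb `]k%:R / N%:R, k.+1%:R / N%:R]%classic) = N%:R^-1.
    rewrite lebesgue_measure_itv/= lte_fin ltr_pM2r ?invr_gt0// ltr_nat ltnSn/=.
    by rewrite -mulrBl -natrB// subSnn mul1r.
  have ic (r : R) : leb.-integrable `]k%:R / N%:R, k.+1%:R / N%:R] (EFin \o cst r).
    apply: (@integrableS _ _ _ leb `[0, 1]%classic) => //.
      apply: subset_trans (sub _ kN); apply: subset_itvr; rewrite bnd_simp divr_ge0//.
    apply: continuous_compact_integrable; first exact: segment_compact.
    by apply: continuous_subspaceT => x; exact: cvg_cst.
  have Ic (r : R) : (\int[leb]_(t in `]k%:R / N%:R, k.+1%:R / N%:R]) r)%R = r * N%:R^-1.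
    by rewrite Rintegral_cst// len.
  have up : (\int[leb]_(t in `]k%:R / N%:R, k.+1%:R / N%:R]) f t)%R <=
      (c k + del k) * N%:R^-1.
    rewrite -Ic; apply: le_Rintegral => //; first exact: ic.
    move=> t /=; rewrite in_itv/= => /andP[t1 t2].
    by have := Hf k kN t t1 t2; rewrite ler_norml lerBlDl => /andP[].
  have dn : (c k - del k) * N%:R^-1 <=
      (\int[leb]_(t in `]k%:R / N%:R, k.+1%:R / N%:R]) f t)%R.
    rewrite -Ic; apply: le_Rintegral => //; first exact: ic.
    move=> t /=; rewrite in_itv/= => /andP[t1 t2].
    by have := Hf k kN t t1 t2; rewrite ler_norml lerBrDr addrC => /andP[].
  by rewrite !big_ord_recr/=; exact: step_error_add ih E up dn.
by have := step N (leqnn N); rewrite divff ?gt_eqF.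
Qed.

End riemann.

(** * Averages over almost equidistributed points *)

Section empirical_sums.
Context (R : realType).
Local Notation leb := (@lebesgue_measure R).

Lemma sum_ltn_le N m : (\sum_(j < N) (j < m)%N <= m)%N.
Proof.
elim: N => [|N ih]; first by rewrite big_ord0.
rewrite big_ord_recr/=; have [Nm|] := ltnP N m; last by rewrite addn0.
rewrite addn1 (leq_trans _ Nm)// ltnS -[leqRHS]card_ord -sum1_card.
by apply: leq_sum => j _; case: ltnP.
Qed.

(** A point within [eps] of j / N can only leave [0, 1] if [j] is within
    eps N of an end of the range. *)
Lemma outside_frequency_le (eps : R) N (z : nat -> R) : (0 < N)%N ->
  N%:R^-1 <= eps -> (forall j, (j < N)%N -> `|z j - j%:R / N%:R| <= eps) ->
  N%:R^-1 * \sum_(j < N) (~~ (0 <= z j <= 1))%:R <= 4 * eps.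
Proof.
move=> N0 Ne Hz; have N0r : 0 < N%:R :> R by rewrite ltr0n.
pose m := (Num.truncn (eps * N%:R)).+1.
have eN : 1 <= eps * N%:R by rewrite -ler_pdivrMr// div1r.
have mE : m%:R <= 2 * (eps * N%:R).
  rewrite /m -natr1; apply: (@le_trans _ _ (eps * N%:R + 1)); last by lra.
  by rewrite lerD2r truncn_le (le_trans ler01).
have bad j : (j < N)%N -> (~~ (0 <= z j <= 1)%R <= (j < m) + (N - j.+1 < m))%N.
  move=> jN; case: (boolP (0 <= z j <= 1)) => //=; rewrite negb_and -!ltNge.
  have := Hz j jN; rewrite ler_norml => /andP[H1 H2] /orP[zj|zj].
    suff -> : (j < m)%N by [].
    have jr : j%:R <= eps * N%:R by rewrite -ler_pdivrMr//; move: H1 zj; lra.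
    by rewrite /m ltnS truncn_ge_nat// (le_trans ler01).
  suff -> : (N - j.+1 < m)%N by rewrite addn1.
  have jr : (N - j)%:R <= eps * N%:R.
    rewrite natrB 1?ltnW// -ler_pdivrMr// mulrBl divff ?gt_eqF//.
    by move: H2 zj; lra.
  have : (N - j <= Num.truncn (eps * N%:R))%N by rewrite truncn_ge_nat// (le_trans ler01).
  by rewrite /m; lia.
rewrite mulrC ler_pdivrMr//.
apply: (@le_trans _ _ (\sum_(j < N) ((j < m) + (N - j.+1 < m)))%N%:R).
  by rewrite natr_sum; apply: ler_sum => j _; rewrite ler_nat; exact: bad.
apply: (@le_trans _ _ (m + m)%:R); last by rewrite natrD; lra.
rewrite ler_nat big_split/= leq_add ?sum_ltn_le//.
rewrite (reindex_inj rev_ord_inj)/=; apply: leq_trans (sum_ltn_le N m).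
apply: leq_sum => j _; have -> // : (N - (N - j.+1).+1 = j)%N.
by have := ltn_ord j; lia.
Qed.

(** Points inside [0, 1] are compared with their cell by uniform continuity;
    the points outside contribute the value 0 instead of one bounded by [B],
    and they are a proportion of at most [4 * e]. *)
Lemma empirical_sum_cvg (f : R -> R) (N : nat -> nat) (z : nat -> nat -> R) :
  {within `[0, 1], continuous f} ->
  (forall eps : R, 0 < eps -> \forall n \near \oo, [/\ (0 < N n)%N,
    (N n)%:R^-1 <= eps &
    forall j, (j < N n)%N -> `|z n j - j%:R / (N n)%:R| <= eps]) ->
  (N n)%:R^-1 * \sum_(j < N n) \1_(`[0, 1]%classic) (z n j) * f (z n j) @[n --> \oo] -->
    (\int[leb]_(t in `[0%R, 1%R]) f t)%R.
Proof.
move=> cf Hz.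
have intf : leb.-integrable `[0, 1] (EFin \o f).
  by apply: continuous_compact_integrable => //; exact: segment_compact.
have [B B0 HB] : exists2 B : R, 0 < B & forall t, 0 <= t <= 1 -> `|f t| <= B.
  have /compact_bounded[M [_ HM]] := continuous_compact cf (@segment_compact R 0 1).
  exists (`|M| + 1); first by rewrite ltr_wpDl.
  move=> t t01; apply: HM; first by rewrite ltr_pwDr// ler_norm.
  by exists t => //=; rewrite in_itv.
apply/cvgrPdist_le => eps e0; have e2 : 0 < eps / 2 by rewrite divr_gt0.
have [del del0 Hdel] := uniform_continuity01 cf e2.
(* A cell has width at most [e], hence [del / 2]; the points outside [0, 1]
   cost at most B * (4 * e) <= eps / 2. *)
pose e := Num.min (del / 2) (eps / (8 * B)).
have ep : 0 < e by rewrite lt_min !divr_gt0// mulr_gt0.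
apply: filterS (Hz e ep) => n [Nn0 Nne Hn].
have Nr : 0 < (N n)%:R :> R by rewrite ltr0n.
have e1 : e <= del / 2 by rewrite ge_min lexx.
have e3 : e <= eps / (8 * B) by rewrite ge_min lexx orbT.
pose c j := \1_(`[0, 1]%classic) (z n j) * f (z n j).
pose err j : R := eps / 2 + B * (~~ (0 <= z n j <= 1))%:R.
apply: (@le_trans _ _ ((N n)%:R^-1 * \sum_(j < N n) err j)).
  apply: (@Rintegral_step_approx _ f (N n) c err) => //.
  move=> j jN t t1 t2.
  have t01 : 0 <= t <= 1.
    rewrite (le_trans _ (ltW t1)) ?divr_ge0//=.
    by rewrite (le_trans t2)// ler_pdivrMr// mul1r ler_nat.
  rewrite /c /err indicE; case: (boolP (0 <= z n j <= 1)) => zj.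
    rewrite mem_set ?mul1r ?mulr0 ?addr0; last by rewrite /= in_itv.
    apply: Hdel => //; have := Hn j jN; rewrite distrC ler_norml => /andP[].
    move: t2; rewrite -natr1 mulrDl div1r => t2 z1 z2.
    by rewrite ler_norml; apply/andP; split; move: t1 t2 z1 z2 e1 Nne; lra.
  rewrite memNset ?mul0r ?subr0 ?mulr1; last by rewrite /= in_itv/=; exact/negP.
  by apply: (le_trans (HB _ t01)); rewrite lerDr ltW.
rewrite big_split/= sumr_const card_ord -mulr_sumr mulrDr [X in _ + X]mulrCA.
rewrite -[eps / 2 *+ _]mulr_natr [X in X + _](_ : _ = eps / 2); last first.
  by field; rewrite gt_eqF.
have := outside_frequency_le Nn0 Nne Hn; move=> /(ler_wpM2l (ltW B0)).
have : B * (4 * e) <= eps / 2.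
  rewrite mulrA -ler_pdivlMl ?mulr_gt0//.
  by apply: (le_trans e3); rewrite le_eqVlt; apply/orP; left; apply/eqP; field; rewrite gt_eqF.
by move=> h1 h2; rewrite [leRHS]splitr lerD2l; exact: le_trans h2 h1.
Qed.

(** The empirical measure is a multiple of a finite sum of Dirac masses. *)
Lemma ge0_integral_empirical (A : {fset int}) (z : int -> R) (f : R -> R) :
  measurable_fun (`[0, 1]%classic : set (measurableTypeR R)) f -> (forall t, 0 <= f t) ->
  (\int[empirical_measure A z]_(t in `[0%R, 1%R]) (f t)%:E =
   ((#|` A|%:R)^-1 * \sum_(i <- A) \1_(`[0, 1]%classic) (z i) * f (z i))%:E)%E.
Proof.
move=> mf f0.
have c0 : 0 <= (#|` A|%:R)^-1 :> R by [].
pose m := mscale (NngNum c0)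
    (msum (fun k => @dirac _ (measurableTypeR R) (z (nth 0 A k)) R) #|` A|).
rewrite (@eq_measure_integral _ _ R _ m); last first.
  move=> B _ _; rewrite /m /mscale /msum /= /empirical_measure EFinM.
  by rewrite -sumEFin (big_nth 0) big_mkord.
have mfE : measurable_fun (`[0, 1]%classic : set (measurableTypeR R))
    (EFin \o f) by exact/measurable_EFinP.
rewrite ge0_integral_mscale//; last by move=> t _; rewrite lee_fin.
rewrite ge0_integral_measure_sum//; last by move=> t _; rewrite lee_fin.
rewrite EFinM; congr (_ * _)%E; rewrite -sumEFin (big_nth 0) big_mkord.
apply: eq_bigr => k _; rewrite integral_dirac//.
Qed.

Lemma integral_empirical (A : {fset int}) (z : int -> R) (f : R -> R) :
  measurable_fun (`[0, 1]%classic : set (measurableTypeR R)) f ->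
  (\int[empirical_measure A z]_(t in `[0%R, 1%R]) (f t)%:E =
   ((#|` A|%:R)^-1 * \sum_(i <- A) \1_(`[0, 1]%classic) (z i) * f (z i))%:E)%E.
Proof.
move=> mf; rewrite integralE.
pose fp t := Num.max (f t) 0; pose fn t := Num.max (- f t) 0.
transitivity ((\int[empirical_measure A z]_(t in `[0%R, 1%R]) (fp t)%:E -
    \int[empirical_measure A z]_(t in `[0%R, 1%R]) (fn t)%:E)%E).
  congr (_ - _)%E; apply: eq_integral => t _.
    by rewrite funeposE /fp EFin_max.
  by rewrite funenegE /fn EFin_max.
rewrite !ge0_integral_empirical.
- rewrite -EFinB -mulrBr -sumrB; congr (_ * _)%:E; apply: eq_bigr => i _.
  rewrite -mulrBr; congr (_ * _); rewrite /fp /fn.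
  by have [h|h] := lerP (f (z i)) 0; [rewrite max_l ?oppr_ge0//; lra|rewrite max_r; lra].
- by apply: measurable_maxr => //; exact: measurableT_comp.
- by move=> t; rewrite le_max lexx orbT.
- exact: measurable_maxr.
- by move=> t; rewrite le_max lexx orbT.
Qed.

End empirical_sums.

(** * Weak convergence of the empirical measures *)

Section weak_convergence.
Context (R : realType) (x : int -> nat -> int).
Hypothesis pm : forall i k, (1 <= k)%N -> x i k = 1 \/ x i k = -1.

Lemma perm_active_range n l r : active_range R x n l r ->
  perm_eq (fset_set (active R x n)) [seq k%:Z - l%:Z | k <- iota 0 (l + r).+1].
Proof.
move=> rng; have mem i : active R x n i <-> i \in [seq k%:Z - l%:Z | k <- iota 0 (l + r).+1].
  rewrite rng; split => [lir|/mapP[k]].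
    apply/mapP; exists (absz (i + l%:Z)); last by lia.
    by rewrite mem_iota; lia.
  by rewrite mem_iota => kN ->; lia.
have fin : finite_set (active R x n).
  apply: (@sub_finite_set _ _ [set` [seq k%:Z - l%:Z | k <- iota 0 (l + r).+1]]).
    by move=> i /mem.
  exact: finite_seq.
apply: uniq_perm => [||i].
- exact: fset_uniq.
- rewrite map_inj_uniq ?iota_uniq// => a b; lia.
- rewrite in_fset_set//; apply/idP/idP; first by rewrite inE => /mem.
  by move=> /mem; rewrite inE.
Qed.

Lemma integral_frog_measure (vmin vmax : R) n l r (f : R -> R) :
  active_range R x n l r ->
  measurable_fun (`[0, 1]%classic : set (measurableTypeR R)) f ->
  let z k := rescaled_position vmin vmax x n (k%:Z - l%:Z) in
  (\int[frog_measure vmin vmax x n]_(t in `[0%R, 1%R]) (f t)%:E =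
   ((l + r).+1%:R^-1 *
    \sum_(k < (l + r).+1) \1_(`[0, 1]%classic) (z k) * f (z k))%:E)%E.
Proof.
move=> rng mf z; have pe := perm_active_range rng.
rewrite integral_empirical//; congr (_^-1 * _)%:E.
  by rewrite /= (perm_size pe) size_map size_iota.
by rewrite (perm_big _ pe) big_map -[X in iota _ X]subn0 -/(index_iota 0 _) big_mkord.
Qed.

Variables (mu vmin vmax : R).
Hypothesis lln : forall eps : R, 0 < eps -> exists C : R, forall i m,
  `|(walk x i m)%:~R - mu * m%:R| <= eps * (`|i|%N + m)%:R + C.
Hypothesis right_speed : rightmost R x n / n%:R @[n --> \oo] --> vmax.
Hypothesis left_speed : leftmost R x n / n%:R @[n --> \oo] --> vmin.
Hypothesis vmax0 : 0 < vmax.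
Hypothesis speeds : (mu = 0 /\ vmin <= 0) \/ [/\ 0 < mu, vmin = mu & mu < vmax].

Lemma frog_measure_cvg : weak_cvg01 (frog_measure vmin vmax x) lebesgue_measure.
Proof.
move=> f cf.
have intf : (@lebesgue_measure R).-integrable `[0, 1] (EFin \o f).
  by apply: continuous_compact_integrable => //; exact: segment_compact.
have mf : measurable_fun (`[0, 1]%classic : set (measurableTypeR R)) f.
  by apply: subspace_continuous_measurable_fun => //; exact: measurable_itv.
have /choice[lr Hlr] n : exists lr : nat * nat, active_range R x n lr.1 lr.2.
  by have [l [r H]] := ex_active_range R pm n; exists (l, r).
pose N n := ((lr n).1 + (lr n).2).+1.
pose z n k := rescaled_position vmin vmax x n (k%:Z - (lr n).1%:Z).
rewrite (_ : (fun n => _) = (fun n => ((N n)%:R^-1 *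
    \sum_(k < N n) \1_(`[0, 1]%classic) (z n k) * f (z n k))%:E)); last first.
  by apply/funext => n; rewrite (integral_frog_measure vmin vmax (Hlr n) mf).
rewrite [X in _ --> X](_ : _ = ((\int[lebesgue_measure]_(t in `[0%R, 1%R]) f t)%R)%:E).
  apply: cvg_EFin; first by apply: nearW => n.
  apply: empirical_sum_cvg => // eps e0.
  have v2 : 0 < vmax / 2 by rewrite divr_gt0.
  have [C HC] := active_range_right_speed pm right_speed v2.
  have U := rescaled_position_near_uniform pm lln right_speed left_speed vmax0 speeds e0.
  near=> n; split => //.
    have := HC n _ _ (Hlr n); rewrite (max_l (ltW vmax0)) ler_norml => /andP[K _].
    have Nr : ((lr n).2)%:R <= (N n)%:R :> R by rewrite ler_nat /N; lia.
    have ln : (C + eps^-1) / (vmax / 2) <= n%:R.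
      near: n; exists (Num.truncn ((C + eps^-1) / (vmax / 2))).+1 => // m /= Hm.
      by apply: (le_trans (ltW (truncnS_gt _))); rewrite ler_nat.
    rewrite ler_pdivrMr// in ln.
    by rewrite invf_ple ?posrE ?ltr0n//; move: K Nr ln; lra.
  move=> j jN; have H : forall l r, active_range R x n l r -> forall i,
    - l%:Z <= i <= r%:Z ->
    `|rescaled_position vmin vmax x n i - (i + l%:Z)%:~R / (l + r).+1%:R| <= eps.
    by near: n; exact: U.
  have := H _ _ (Hlr n) (j%:Z - (lr n).1%:Z).
  by rewrite subrK; apply; move: jN; rewrite /N; lia.
by rewrite /Rintegral fineK//; exact: integrable_fin_num.
Unshelve. all: by end_near. Qed.

End weak_convergence.

Lemma walk_of_bits (R : realType) d (T : measurableType d) (bit : int * nat -> T -> bool)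
    (x : int -> nat -> int) (w : T) :
  (forall i k, (1 <= k)%N -> x i k = if bit (i, k) w then 1 else -1) ->
  forall i m, bit_walk R bit w i m = (walk x i m)%:~R.
Proof.
move=> xb i m; rewrite /bit_walk /walk rmorph_sum/=; apply: eq_big_nat => k /andP[k1 _].
by rewrite xb// /pm1; case: (bit _ _); rewrite ?rmorphN.
Qed.

Theorem theorem1p4 (R : realType) (d : measure_display) (T : measurableType d)
  (P : probability T R) (p : R) (X : int -> nat -> {RV P >-> int})
  (vmin vmax : R) :
  2^-1 <= p -> p < 1 ->
  iid [set ik : int * nat | (1 <= ik.2)%N] (fun ik => X ik.1 ik.2) ->
  P (X 0 1%N @^-1` [set 1]) = p%:E ->
  P (X 0 1%N @^-1` [set -1]) = (1 - p)%:E ->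
  0 < vmax ->
  {ae P, forall w, rightmost R (fun i k => X i k w) n / n%:R @[n --> \oo] --> vmax} ->
  {ae P, forall w, leftmost R (fun i k => X i k w) n / n%:R @[n --> \oo] --> vmin} ->
  {ae P, forall w,
    weak_cvg01 (frog_measure vmin vmax (fun i k => X i k w)) lebesgue_measure}.
Proof.
move=> p2 p1 iidX Xp Xq vmax0 right_speed left_speed.
have p01 : 0 <= p <= 1 by apply/andP; split; lra.
have Hb := bernoulli_step_bit iidX Xp.
pose mu : R := 2 * p - 1.
pose x (w : T) i k := X i k w.
pose good w := [/\ forall i k, (1 <= k)%N ->
    x w i k = if step_bit X (i, k) w then 1 else -1,
  forall eps : R, 0 < eps -> exists C : R, forall i m,
    `|(walk (x w) i m)%:~R - mu * m%:R| <= eps * (`|i|%N + m)%:R + C,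
  rightmost R (x w) n / n%:R @[n --> \oo] --> vmax &
  leftmost R (x w) n / n%:R @[n --> \oo] --> vmin].
have pm w : good w -> forall i k, (1 <= k)%N -> x w i k = 1 \/ x w i k = -1.
  by move=> [xb _ _ _] i k k1; rewrite xb//; case: (step_bit _ _); [left|right].
have ae_good : {ae P, forall w, good w}.
  have pm1 := ae_step_pm1 iidX Xp Xq; have lln := ae_uniform_lln p01 Hb.
  near=> w; have xb : forall i k, (1 <= k)%N ->
      x w i k = if step_bit X (i, k) w then 1 else -1.
    have Hw : forall i k, (1 <= k)%N -> X i k w = 1 \/ X i k w = -1 by near: w.
    by move=> i k k1; rewrite /x /step_bit/=; case: (Hw i k k1) => ->.
  split => //.
  - move=> eps e0; have Hw : forall eps : R, 0 < eps -> exists C : R, forall i m,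
      `|bit_walk R (step_bit X) w i m - (2 * p - 1) * m%:R| <= eps * (`|i|%N + m)%:R + C.
      by near: w.
    have [C HC] := Hw eps e0; exists C => i m.
    by rewrite -(walk_of_bits R xb); exact: HC.
  - by near: w.
  - by near: w.
have drift w : good w -> vmin <= mu.
  by move=> gw; case: (gw) => _ lln _ ls; 
  exact: (@left_speed_le_drift R (x w) (pm w gw) mu lln vmin ls).
have speeds w : good w ->
    (mu = 0 /\ vmin <= 0) \/ [/\ 0 < mu, vmin = mu & mu < vmax].
  move: p2; rewrite le_eqVlt => /predU1P[p2|p2] gw.
    have mu0 : mu = 0 by rewrite /mu -p2; lra.
    by left; split => //; rewrite -mu0; exact: drift gw.
  (* The speeds are constants: one good outcome suffices to compare them with
     the drift. *)
  have [kap [lam [eta [kap0 lam0 eta0 strat]]]] := ae_strategy_small p2 p1 Hb.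
  have [w' [[gw' sw'] noleft]] := exists_no_left_escape p2 (ltW p1) Hb (filterI ae_good strat).
  have [xb lln rs ls] := gw'.
  have vmu : mu + eta <= vmax.
    exact: (@strategy_speed R kap lam (x w') _ (ltW kap0) xb lam0 _ _ rs vmax0 sw').
  have mu0 : 0 < mu by rewrite /mu; lra.
  right; split => //; last by lra.
  apply/eqP; rewrite eq_le (drift w gw)/=.
  apply: (@drift_le_left_speed R (x w') (pm w' gw') mu lln vmin ls vmax rs) => //;
    [exact: ltW|by lra|].
  move=> a m; rewrite -(ler_int R) rmorphD/= -(walk_of_bits R xb).
  exact: noleft.
apply: filterS ae_good => w gw; case: (gw) => _ lln rs ls.
exact: (@frog_measure_cvg R (x w) (pm w gw) mu vmin vmax lln rs ls vmax0 (speeds w gw)).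
Unshelve. all: by end_near. Qed.
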